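(* Let $M$ be the Atiyah--Hitchin manifold with its Riemannian metric $ds^2$ (depending on a parameter $m>0$), and let $\Sigma=\{r=0\}\subset M$ be its zero section, a minimal $2$-sphere. Then $\Sigma$ is strongly stable; that is, at every point of $\Sigma$ the symmetric endomorphism $\mathcal{R}-\mathcal{A}$ of the normal space of $\Sigma$ is positive definite.
   Context: **The Atiyah--Hitchin manifold $M$.** The underlying manifold of $M$ is the total space of the complex line bundle of degree $-4$ over $S^2$. Let $z,w$ be the standard complex charts on $S^2$ with $z=1/w$. Over the $z$-chart the fiber coordinate is $re^{i\psi}$ with $r\ge 0$, $e^{i\psi}\in S^1$; on the other chart the coordinates are $(w,re^{i\varphi})$ with $(w,\varphi)=(1/z,\psi+4\arg z)$. On the unit circle bundle put $$\sigma^1=\tfrac12\Big(d\psi+2i\,\frac{z\,d\bar z-\bar z\,dz}{1+|z|^2}\Big),\quad \sigma^2=\mathrm{Re}\Big[\frac{2e^{i\psi/2}dz}{1+|z|^2}\Big],\quad \sigma^3=\mathrm{Im}\Big[\frac{2e^{i\psi/2}dz}{1+|z|^2}\Big].$$ The forms $\sigma^2,\sigma^3$ are defined only up to a common sign, but $(\sigma^2)^2,(\sigma^3)^2,\sigma^2\wedge\sigma^3$ are well defined; $d\sigma^1=\sigma^2\wedge\sigma^3$ and cyclic permutations hold. The Riemannian metric on $M$ is $$ds^2=dr^2+a^2(\sigma^1)^2+b^2(\sigma^2)^2+c^2(\sigma^3)^2,$$ where $a,b,c$ are the functions of $r\in[0,\infty)$ solving $$a'=\frac{a^2-(b-c)^2}{2bc},\quad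 b'=\frac{b^2-(c-a)^2}{2ca},\quad c'=\frac{c^2-(a-b)^2}{2ab},$$ with initial conditions $a(0)=0$, $b(0)=-m$, $c(0)=m$ for a constant $m>0$ (prime denotes $d/dr$). This is the solution smooth up to $r=0$, defined for all $r\ge0$, with $a,c>0$ and $b<0$ for $r>0$. The metric is smooth across $r=0$ and complete, and $r$ is the geodesic distance to the zero section. $M$ is oriented by $dr\wedge\sigma^1\wedge\sigma^2\wedge\sigma^3$. The zero section $\Sigma=\{r=0\}$ is a $2$-sphere, round of radius $m$ in the induced metric, and oriented by $\sigma^2\wedge\sigma^3$; it is a minimal surface. **Strong stability.** Curvature convention: $R(X,Y,Z,W)=\langle\nabla_Z\nabla_WY-\nabla_W\nabla_ZY-\nabla_{[Z,W]}Y,X\rangle$. For a minimal submanifold, take a local orthonormal frame with tangential indices $\ell,k$ and normal indices $\mu,\nu$, write $R_{\ell\mu\ell\nu}=R(e_\ell,e_\mu,e_\ell,e_\nu)$, and let $h_{\mu\ell k}=\langle\nabla_{e_\ell}e_k,e_\mu\rangle$ be the components of the second fundamental form. On a normal vector $V=\sum_\mu V^\mu e_\mu$ define $$(\mathcal{R}-\mathcal{A})(V)=\sum_{\mu,\nu}\Big[-\sum_\ell R_{\ell\mu\ell\nu}V^\mu-\sum_{\ell,k}h_{\mu\ell k}h_{\nu\ell k}V^\mu\Big]e_\nu .$$ (The Jacobi operator of the volume functional is $(\nabla^\perp)^*\nabla^\perp+\mathcal{R}-\mathcal{A}$.) The minimal submanifold is called strongly stable if $\mathcal{R}-\mathcal{A}$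 is pointwise positive definite on the normal bundle. *)

(* Defs.v *)
From HB Require Import structures.
From mathcomp Require Import all_boot all_order all_algebra.
From mathcomp Require Import all_classical all_reals all_analysis.
From mathcomp Require Import complex.

Set Implicit Arguments.
Unset Strict Implicit.
Unset Printing Implicit Defensive.

Import Order.TTheory GRing.Theory Num.Theory.
Import numFieldNormedType.Exports.

Local Open Scope ring_scope.

(** ** Riemannian geometry on a coordinate space R^n = 'rV[R]_n *)

Fixpoint Ck (R : realType) (V : normedModType R) (k : nat) (f : V -> R) : Prop :=
  match k with
  | 0 => continuous f
  | k'.+1 => (forall p : V, differentiable f p) /\
             (forall v : V, Ck k' ('D_v f : V -> R))
  end.

Definition smooth (R : realType) (V : normedModType R) (f : V -> R) : Prop :=
  forall k : nat, Ck k f.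

Definition dirD (R : realType) (n m : nat) (F : 'rV[R]_n -> 'rV[R]_m)
    (p v : 'rV[R]_n) : 'rV[R]_m :=
  \row_k 'D_v (fun q : 'rV[R]_n => F q 0 k) p.

Definition partial (R : realType) (n : nat) (i : 'I_n) (f : 'rV[R]_n -> R)
    (p : 'rV[R]_n) : R :=
  'D_(delta_mx 0 i) f p.

(* A metric is given by its Gram matrix (g_ij) in the coordinate frame. *)
Definition inner (R : realType) (n : nat) (g : 'rV[R]_n -> 'M[R]_n)
    (p v w : 'rV[R]_n) : R :=
  (v *m g p *m w^T) 0 0.

Definition riemannian_metric (R : realType) (n : nat)
    (g : 'rV[R]_n -> 'M[R]_n) : Prop :=
  [/\ forall i j : 'I_n, smooth (fun p : 'rV[R]_n => g p i j),
      forall (p : 'rV[R]_n) (i j : 'I_n), g p i j = g p j i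
    & forall p v : 'rV[R]_n, v != 0 -> 0 < inner g p v v].

(* Gamma^k_ij of the Levi-Civita connection *)
Definition christoffel (R : realType) (n : nat) (g : 'rV[R]_n -> 'M[R]_n)
    (k i j : 'I_n) (p : 'rV[R]_n) : R :=
  2^-1 * \sum_(l < n) invmx (g p) k l *
    (partial i (fun q => g q j l) p + partial j (fun q => g q i l) p
     - partial l (fun q => g q i j) p).

Definition nabla (R : realType) (n : nat) (g : 'rV[R]_n -> 'M[R]_n)
    (X Y : 'rV[R]_n -> 'rV[R]_n) (p : 'rV[R]_n) : 'rV[R]_n :=
  dirD Y p (X p) +
  \row_k \sum_(i < n) \sum_(j < n) christoffel g k i j p * X p 0 i * Y p 0 j.

Definition lie_bracket (R : realType) (n : nat)
    (X Y : 'rV[R]_n -> 'rV[R]_n) (p : 'rV[R]_n) : 'rV[R]_n :=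
  dirD Y p (X p) - dirD X p (Y p).

(* <nabla_Z nabla_W Y - nabla_W nabla_Z Y - nabla_[Z,W] Y, X> *)
Definition curvature_fields (R : realType) (n : nat) (g : 'rV[R]_n -> 'M[R]_n)
    (X Y Z W : 'rV[R]_n -> 'rV[R]_n) (p : 'rV[R]_n) : R :=
  inner g p
    (nabla g Z (nabla g W Y) p - nabla g W (nabla g Z Y) p
     - nabla g (lie_bracket Z W) Y p)
    (X p).

(* The curvature is a tensor: its value on tangent vectors at p may be computed
   with any extension to vector fields, here the constant-coefficient one. *)
Definition curvature (R : realType) (n : nat) (g : 'rV[R]_n -> 'M[R]_n)
    (p x y z w : 'rV[R]_n) : R :=
  curvature_fields g (fun=> x) (fun=> y) (fun=> z) (fun=> w) p.

(** ** Submanifolds in adapted coordinates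

    The submanifold is the slice of R^(s + t) on which the last t coordinates
    vanish. *)

Definition on_slice (R : realType) (s t : nat) (p : 'rV[R]_(s + t)) : Prop :=
  rsubmx p = 0.

Definition tangent (R : realType) (s t : nat) (v : 'rV[R]_(s + t)) : Prop :=
  rsubmx v = 0.

Definition normal (R : realType) (s t : nat)
    (g : 'rV[R]_(s + t) -> 'M[R]_(s + t)) (p v : 'rV[R]_(s + t)) : Prop :=
  forall w : 'rV[R]_(s + t), tangent w -> inner g p v w = 0.

(* <nabla_x y, nu>; for tangent x and y the constant-coefficient extension of y
   stays tangent along the slice, so this is the second fundamental form. *)
Definition second_form (R : realType) (s t : nat)
    (g : 'rV[R]_(s + t) -> 'M[R]_(s + t)) (p nu x y : 'rV[R]_(s + t)) : R :=
  inner g p (nabla g (fun=> x) (fun=> y) p) nu.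

(* e_1, ..., e_s tangent and nu_1, ..., nu_t normal *)
Definition adapted_frame (R : realType) (s t : nat)
    (g : 'rV[R]_(s + t) -> 'M[R]_(s + t)) (p : 'rV[R]_(s + t))
    (e : 'I_s -> 'rV[R]_(s + t)) (nu : 'I_t -> 'rV[R]_(s + t)) : Prop :=
  [/\ forall l, tangent (e l),
      forall mu, normal g p (nu mu),
      forall l k, inner g p (e l) (e k) = (l == k)%:R
    & forall mu mu', inner g p (nu mu) (nu mu') = (mu == mu')%:R].

Definition minimal (R : realType) (s t : nat)
    (g : 'rV[R]_(s + t) -> 'M[R]_(s + t)) : Prop :=
  forall (p : 'rV[R]_(s + t)) (e : 'I_s -> 'rV[R]_(s + t))
         (nu : 'I_t -> 'rV[R]_(s + t)),
    on_slice p -> adapted_frame g p e nu ->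
    forall mu, \sum_(l < s) second_form g p (nu mu) (e l) (e l) = 0.

(* The endomorphism R - A of the normal space, written in an adapted frame. *)
Definition RminusA (R : realType) (s t : nat)
    (g : 'rV[R]_(s + t) -> 'M[R]_(s + t)) (p : 'rV[R]_(s + t))
    (e : 'I_s -> 'rV[R]_(s + t)) (nu : 'I_t -> 'rV[R]_(s + t))
    (V : 'rV[R]_(s + t)) : 'rV[R]_(s + t) :=
  \sum_(mu < t) \sum_(mu' < t)
    ((- (\sum_(l < s) curvature g p (e l) (nu mu) (e l) (nu mu'))
      - \sum_(l < s) \sum_(k < s)
          second_form g p (nu mu) (e l) (e k) *
          second_form g p (nu mu') (e l) (e k))
     * inner g p V (nu mu)) *: nu mu'.

Definition positive_definite_on (R : realType) (n : nat)
    (g : 'rV[R]_n -> 'M[R]_n) (p : 'rV[R]_n) (N : 'rV[R]_n -> Prop)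
    (T : 'rV[R]_n -> 'rV[R]_n) : Prop :=
  (forall v w, N v -> N w -> inner g p (T v) w = inner g p v (T w)) /\
  (forall v, N v -> v != 0 -> 0 < inner g p (T v) v).

Definition strongly_stable (R : realType) (s t : nat)
    (g : 'rV[R]_(s + t) -> 'M[R]_(s + t)) : Prop :=
  minimal g /\
  forall (p : 'rV[R]_(s + t)) (e : 'I_s -> 'rV[R]_(s + t))
         (nu : 'I_t -> 'rV[R]_(s + t)),
    on_slice p -> adapted_frame g p e nu ->
    positive_definite_on g p (normal g p) (RminusA g p e nu).

(** ** The Atiyah-Hitchin manifold

    The total space of the degree -4 line bundle over S^2 is glued from two
    copies of C x C = R^4.  A point of a copy is a base coordinate together with
    the fiber coordinate r e^(i psi), so the zero section is in both copies the
    slice where the last two real coordinates vanish. *)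

Section AtiyahHitchin.
Local Open Scope complex_scope.

Definition complex_row (R : realType) (z : R[i]) : 'rV[R]_2 :=
  \row_(j < 2) (if j == 0 then complex.Re z else complex.Im z).

Definition row_complex (R : realType) (v : 'rV[R]_2) : R[i] :=
  (v 0 0) +i* (v 0 1).

Definition point (R : realType) (z zeta : R[i]) : 'rV[R]_(2 + 2) :=
  row_mx (complex_row z) (complex_row zeta).

Definition base (R : realType) (p : 'rV[R]_(2 + 2)) : R[i] :=
  row_complex (lsubmx p).

Definition fiber (R : realType) (p : 'rV[R]_(2 + 2)) : R[i] :=
  row_complex (rsubmx p).

Definition expi (R : realType) (t : R) : R[i] := (cos t) +i* (sin t).

(* (w, phi) = (1/z, psi + 4 arg z), with e^(i arg z) = z / |z| *)
Definition transition (R : realType) (p : 'rV[R]_(2 + 2)) : 'rV[R]_(2 + 2) :=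
  point (base p)^-1 (fiber p * (base p / (Normc.normc (base p))%:C) ^+ 4).

(* The forms at (z, psi) evaluated on the tangent vector with components
   dz : R[i] and dpsi : R; the expression in sigma1 is real. *)
Definition sigma1 (R : realType) (z dz : R[i]) (dpsi : R) : R :=
  complex.Re (2^-1 * (dpsi%:C +
    2 * (0 +i* 1) * (z * conjc dz - conjc z * dz) / (1 + (Normc.normc z ^+ 2)%:C))).

Definition sigma23 (R : realType) (z : R[i]) (psi : R) (dz : R[i]) : R[i] :=
  2 * expi (psi / 2) * dz / (1 + (Normc.normc z ^+ 2)%:C).

Definition sigma2 (R : realType) (z : R[i]) (psi : R) (dz : R[i]) : R :=
  complex.Re (sigma23 z psi dz).

Definition sigma3 (R : realType) (z : R[i]) (psi : R) (dz : R[i]) : R :=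
  complex.Im (sigma23 z psi dz).

Definition ds2 (R : realType) (a b c : R -> R) (z : R[i]) (r psi : R)
    (dz : R[i]) (dr dpsi : R) : R :=
  dr ^+ 2 + a r ^+ 2 * sigma1 z dz dpsi ^+ 2
  + b r ^+ 2 * sigma2 z psi dz ^+ 2 + c r ^+ 2 * sigma3 z psi dz ^+ 2.

Definition smooth_on_half_line (R : realType) (f : R -> R) : Prop :=
  exists F : R^o -> R, smooth F /\ forall r : R, 0 <= r -> f r = F r.

(* At r = 0 the right-hand sides for b' and c' are of the form 0/0, so the
   equations are imposed for r > 0 and the solution is smooth up to r = 0. *)
Definition AH_profile (R : realType) (m : R) (a b c : R -> R) : Prop :=
  [/\ [/\ smooth_on_half_line a, smooth_on_half_line b
        & smooth_on_half_line c],
      [/\ a 0 = 0, b 0 = - m & c 0 = m],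
      forall r : R, 0 < r -> [/\ 0 < a r, b r < 0 & 0 < c r]
    & forall r : R, 0 < r ->
      [/\ is_derive r 1 a ((a r ^+ 2 - (b r - c r) ^+ 2) / (2 * b r * c r)),
          is_derive r 1 b ((b r ^+ 2 - (c r - a r) ^+ 2) / (2 * c r * a r))
        & is_derive r 1 c ((c r ^+ 2 - (a r - b r) ^+ 2) / (2 * a r * b r))]].

(* gz and gw express one Riemannian metric on the glued manifold: they agree
   under the transition map.  In polar fiber coordinates of the z-chart the
   metric is ds2; the Cartesian velocity of r e^(i psi) is
   (dr + i r dpsi) e^(i psi).  The forms are only defined off the zero section,
   across which the metric extends smoothly, hence in a unique way; likewise
   over the point w = 0, which the z-chart misses. *)
Definition AH_metric (R : realType) (a b c : R -> R)
    (gz gw : 'rV[R]_(2 + 2) -> 'M[R]_(2 + 2)) : Prop :=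
  [/\ riemannian_metric gz,
      riemannian_metric gw,
      forall p v w : 'rV[R]_(2 + 2), base p != 0 ->
        inner gz p v w =
        inner gw (transition p) (dirD (@transition R) p v)
                                (dirD (@transition R) p w)
    & forall (z : R[i]) (r psi : R) (dz : R[i]) (dr dpsi : R), 0 < r ->
        let v := point dz ((dr +i* (r * dpsi)) * expi psi) in
        inner gz (point z (r%:C * expi psi)) v v = ds2 a b c z r psi dz dr dpsi].

End AtiyahHitchin.

(* Main.v *)
(* The fiber over a point s of the zero section is described by polar
   coordinates t n with n a unit vector, in which the metric is explicit and has
   the same expression in both charts; every derivative of the metric at s is a
   one-sided limit t -> 0+ of explicit difference quotients, and these limits
   only involve a'(0) = 2, b'(0) = c'(0) = 1/2 and (b^2 + c^2)''(0) = 4, which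
   the differential equations force.  By Koszul's formula the partial trace
   sum_l R(e_l, nu, e_l, nu') reduces to the Hessian in normal directions of the
   trace of the tangential metric plus squares of first derivatives; the
   contributions of the connection form cancel, and
   - sum_l R(e_l, nu, e_l, nu') = 3/(2 m^2) <nu, nu'> while
   sum_lk h_nu(l,k) h_nu'(l,k) = 1/(2 m^2) <nu, nu'>,
   so that R - A is the identity of the normal space divided by m^2. *)

Require Import Defs.
From mathcomp Require Import all_boot all_order all_algebra.
From mathcomp Require Import all_classical all_reals all_analysis.
From mathcomp Require Import complex ring lra.

Set Implicit Arguments.
Unset Strict Implicit.
Unset Printing Implicit Defensive.

Import Order.TTheory GRing.Theory Num.Theory.
Import numFieldNormedType.Exports.
Local Open Scope ring_scope.

(** * Koszul's formula and the curvature tensor *)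

(** Smoothness of the metric is a hypothesis, so all derivatives at a point s of the zero section
    exist beforehand and one-sided limits suffice to evaluate them. The obstacle is that polar
    coordinates are singular at s: a first derivative needs a single ray, but a second derivative in
    two different normal directions leaves the ray. The trace removes this obstacle. The half-angle
    forms enter only through b^2 sigma2^2 + c^2 sigma3^2, whose angular dependence is Re(e^(i psi)
    dz^2), a trace-free quadratic form on the base. The traced metric is therefore radial on the
    fiber, and its mixed second derivative vanishes by reflection. The same trace-free form is, up
    to a factor, the second fundamental form, whence minimality. It also explains why both charts
    look alike: under z -> 1/z the form dz^2 acquires the factor z^(-4), whose argument is
    compensated by the rotation (z/|z|)^4 of the fiber and whose modulus by the conformal factor. *)

Section DirectionalDerivatives.
Variables (R : realType) (V : normedModType R).
Implicit Types (f g : V -> R) (p v : V).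

Lemma is_derive_sum_fun n (F : 'I_n -> V -> R) (dF : 'I_n -> R) p v :
  (forall i, is_derive p v (F i) (dF i)) ->
  is_derive p v (fun q => \sum_(i < n) F i q) (\sum_(i < n) dF i).
Proof.
move=> dFi; rewrite (_ : (fun q => _) = \sum_(i < n) F i); first exact: is_derive_sum.
by apply/funext => q; rewrite fct_sumE.
Qed.

Lemma is_derive_mul_fun f g p v (df dg : R) :
  is_derive p v f df -> is_derive p v g dg ->
  is_derive p v (fun q => f q * g q) (df * g p + f p * dg).
Proof.
move=> hf hg; apply: (@is_derive_eq _ _ _ (f * g)).
by rewrite /GRing.scale /= addrC [g p * _]mulrC.
Qed.

Lemma is_derive_mulr_fun f (k : R) p v (df : R) :
  is_derive p v f df -> is_derive p v (fun q => f q * k) (df * k).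
Proof.
move=> hf; have := is_derive_mul_fun hf (is_derive_cst k p v).
by rewrite mulr0 addr0.
Qed.

Lemma is_derive_mull_fun f (k : R) p v (df : R) :
  is_derive p v f df -> is_derive p v (fun q => k * f q) (k * df).
Proof.
move=> hf; have := is_derive_mul_fun (is_derive_cst k p v) hf.
by rewrite mul0r add0r.
Qed.

Lemma derivable_mul_fun f g p v :
  derivable f p v -> derivable g p v -> derivable (fun q => f q * g q) p v.
Proof. by move=> /derivableP hf /derivableP hg; have [] := is_derive_mul_fun hf hg. Qed.

Lemma derivable_mulr_fun f (k : R) p v :
  derivable f p v -> derivable (fun q => f q * k) p v.
Proof. by move=> /derivableP /(is_derive_mulr_fun k) []. Qed.

Lemma derivable_mull_fun f (k : R) p v :
  derivable f p v -> derivable (fun q => k * f q) p v.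
Proof. by move=> /derivableP /(is_derive_mull_fun k) []. Qed.

Lemma derivable_prod_fun n (F : 'I_n -> V -> R) p v :
  (forall i, derivable (F i) p v) -> derivable (fun q => \prod_(i < n) F i q) p v.
Proof.
elim: n F => [|n IH] F hF.
  rewrite (_ : (fun q => _) = cst 1); first exact: derivable_cst.
  by apply/funext => q; rewrite big_ord0.
rewrite (_ : (fun q => _) =
  F ord0 * (fun q => \prod_(i < n) F (lift ord0 i) q)); last first.
  by apply/funext => q; rewrite big_ord_recl.
by apply: derivableM => //; apply: IH => i; exact: hF.
Qed.

Lemma derivable_sum_fun (I : finType) (F : I -> V -> R) p v :
  (forall i, derivable (F i) p v) -> derivable (fun q => \sum_i F i q) p v.
Proof.
move=> hF; rewrite (_ : (fun q => _) = \sum_i F i); last first.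
  by apply/funext => q; rewrite fct_sumE.
elim/big_ind: _ => [|f1 f2 h1 h2|i _] //.
exact: derivableD.
Qed.

Lemma derivable_det n (M : V -> 'M[R]_n) p v :
  (forall i j, derivable (fun q => M q i j) p v) ->
  derivable (fun q => \det (M q)) p v.
Proof.
move=> hM; rewrite /determinant; apply: derivable_sum_fun => s.
exact/derivable_mull_fun/derivable_prod_fun.
Qed.

(** Cramer's rule: cofactors and determinant are polynomials in the entries. It is needed because
    the Christoffel symbols contain the inverse Gram matrix. *)
Lemma derivable_invmx n (M : V -> 'M[R]_n) p v :
  (forall q, M q \in unitmx) ->
  (forall i j, derivable (fun q => M q i j) p v) ->
  forall i j, derivable (fun q => invmx (M q) i j) p v.
Proof.
move=> Mu hM i j.
rewrite (_ : (fun q => _) = (fun q => (\det (M q))^-1) *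
    (fun q => cofactor (M q) j i)); last first.
  by apply/funext => q; rewrite /invmx Mu !mxE.
have detn0 q : \det (M q) != 0 by have := Mu q; rewrite unitmxE unitfE.
apply: derivableM; first by apply: derivableV => //; exact: derivable_det.
apply: derivable_mull_fun.
apply: derivable_det => k l.
by rewrite (_ : (fun q => _) = fun q => M q (lift j k) (lift i l)) //;
  apply/funext => q; rewrite !mxE.
Qed.

End DirectionalDerivatives.

Lemma derive_partial (R : realType) n (f : 'rV[R]_n -> R) p v :
  differentiable f p -> 'D_v f p = \sum_(i < n) v 0 i * partial i f p.
Proof.
move=> df; rewrite deriveE // [X in 'd f p X](row_sum_delta v) linear_sum /=.
by apply: eq_bigr => i _; rewrite linearZ /partial deriveE.
Qed.

(** * Levi-Civita connection and curvature on constant-coefficient fields *)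

Section MetricCalculus.
Variables (R : realType) (n : nat) (g : 'rV[R]_n -> 'M[R]_n).
Hypothesis hg : riemannian_metric g.
Implicit Types (p q u v w x y z : 'rV[R]_n).

Lemma innerE p v w :
  inner g p v w = \sum_(i < n) \sum_(j < n) v 0 i * g p i j * w 0 j.
Proof.
rewrite /inner !mxE exchange_big /=; apply: eq_bigr => j _.
by rewrite !mxE mulr_suml.
Qed.

Lemma innerDl p v v' w : inner g p (v + v') w = inner g p v w + inner g p v' w.
Proof. by rewrite /inner !mulmxDl !mxE. Qed.

Lemma innerZl p (h : R) v w : inner g p (h *: v) w = h * inner g p v w.
Proof. by rewrite /inner -!scalemxAl !mxE. Qed.

Lemma inner0l p w : inner g p 0 w = 0.
Proof. by rewrite /inner !mul0mx mxE. Qed.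

Lemma innerC p v w : inner g p v w = inner g p w v.
Proof.
case: hg => _ gC _; rewrite !innerE exchange_big /=.
by apply: eq_bigr => i _; apply: eq_bigr => j _; rewrite (gC p j i); ring.
Qed.

Lemma inner_suml p m (F : 'I_m -> 'rV[R]_n) w :
  inner g p (\sum_i F i) w = \sum_i inner g p (F i) w.
Proof. by rewrite /inner !mulmx_suml summxE. Qed.

Lemma inner_neq0 p v : v != 0 -> 0 < inner g p v v.
Proof. by case: hg => _ _; exact. Qed.

(** A nonzero vector in the kernel of the Gram matrix would have length zero. *)
Lemma metric_unit p : g p \in unitmx.
Proof.
rewrite -row_free_unit; apply/row_freeP; apply: contrapT => nfree.
have : ~~ row_free (g p) by apply/negP => /row_freeP.
rewrite -kermx_eq0 => /rowV0Pn [v /sub_kermxP vg0 v0].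
by have := inner_neq0 p v0; rewrite /inner vg0 mul0mx mxE ltxx.
Qed.

Lemma metric_differentiable i j p : differentiable (fun q => g q i j) p.
Proof. by case: hg => /(_ i j 1%N) [] /(_ p). Qed.

Lemma metric_derivable i j p v : derivable (fun q => g q i j) p v.
Proof. exact/diff_derivable/metric_differentiable. Qed.

Lemma is_derive_inner p v (X Y : 'rV[R]_n -> 'rV[R]_n) :
  (forall k, derivable (fun q => X q 0 k) p v) ->
  (forall k, derivable (fun q => Y q 0 k) p v) ->
  is_derive p v (fun q => inner g q (X q) (Y q))
    (inner g p (dirD X p v) (Y p) + inner g p (X p) (dirD Y p v) +
     \sum_i \sum_j X p 0 i * 'D_v (fun q => g q i j) p * Y p 0 j).
Proof.
move=> dX dY.
rewrite (_ : (fun q => _) =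
  (fun q => \sum_i \sum_j X q 0 i * g q i j * Y q 0 j)); last first.
  by apply/funext => q; rewrite innerE.
apply: is_derive_eq.
  apply: is_derive_sum_fun => i; apply: is_derive_sum_fun => j.
  apply: is_derive_mul_fun; last exact/derivableP.
  by apply: is_derive_mul_fun; apply/derivableP => //; exact: metric_derivable.
rewrite !innerE -!big_split /=; apply: eq_bigr => i _.
by rewrite -!big_split /=; apply: eq_bigr => j _; rewrite !mxE; ring.
Qed.

Lemma is_derive_inner_const p v x y :
  is_derive p v (fun q => inner g q x y)
    (\sum_i \sum_j x 0 i * 'D_v (fun q => g q i j) p * y 0 j).
Proof.
have dc (u : 'rV[R]_n) (k : 'I_n) : derivable (fun=> u 0 k) p v.
  exact: (derivable_cst (u 0 k)).
have d0 (u : 'rV[R]_n) : dirD (fun=> u) p v = 0.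
  apply/rowP => k; rewrite !mxE.
  exact: (derive_cst (V := 'rV[R]_n) (u 0 k)).
have := @is_derive_inner p v (fun=> x) (fun=> y) (dc x) (dc y).
by rewrite !d0 inner0l innerC inner0l !add0r.
Qed.

Lemma inner_differentiable x y p : differentiable (fun q => inner g q x y) p.
Proof.
rewrite (_ : (fun q => _) =
  \sum_i \sum_j (fun q => x 0 i * y 0 j * g q i j)); last first.
  apply/funext => q; rewrite innerE fct_sumE; apply: eq_bigr => i _.
  by rewrite fct_sumE; apply: eq_bigr => j _; rewrite mulrAC.
apply: differentiable_sum => i; apply: differentiable_sum => j.
apply: differentiableM; first exact: differentiable_cst.
exact: metric_differentiable.
Qed.

Lemma inner_derivable x y p v : derivable (fun q => inner g q x y) p v.
Proof. exact/diff_derivable/inner_differentiable. Qed.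

Lemma derive_inner_derivable x y p v w :
  derivable ('D_v (fun q => inner g q x y)) p w.
Proof.
rewrite (_ : 'D_v _ = \sum_i \sum_j
  (fun q => x 0 i * y 0 j * 'D_v (fun q => g q i j) q)); last first.
  apply/funext => q; have [_ ->] := is_derive_inner_const q v x y.
  rewrite fct_sumE; apply: eq_bigr => i _.
  by rewrite fct_sumE; apply: eq_bigr => j _; rewrite mulrAC.
apply: derivable_sum => i; apply: derivable_sum => j.
apply/derivable_mull_fun/diff_derivable; case: hg => /(_ i j 2%N) [_ /(_ v)] [d _] _ _.
exact: d.
Qed.

(** Koszul's expression for <nabla_w y, x> with constant fields, whose brackets drop out of the
    formula. *)
Definition koszul w y x p : R :=
  2^-1 * ('D_w (fun q => inner g q y x) p + 'D_y (fun q => inner g q w x) p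
          - 'D_x (fun q => inner g q w y) p).

Lemma derive_inner_partial w y x p :
  'D_w (fun q => inner g q y x) p =
  \sum_i \sum_j \sum_l w 0 i * y 0 j * x 0 l * partial i (fun q => g q j l) p.
Proof.
have [_ ->] := is_derive_inner_const p w y x.
rewrite (exchange_big_dep predT) //= [RHS](exchange_big_dep predT) //=.
rewrite (exchange_big_dep predT) //=; apply: eq_bigr => j _.
rewrite [RHS](exchange_big_dep predT) //=; apply: eq_bigr => l _.
rewrite derive_partial; last exact: metric_differentiable.
by rewrite mulr_sumr mulr_suml; apply: eq_bigr => i _; ring.
Qed.

Lemma inner_nabla_const w y x p :
  inner g p (nabla g (fun=> w) (fun=> y) p) x = koszul w y x p.
Proof.
(* [L] collects the Christoffel symbols of the first kind contracted with [w] and [y]; pairing with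
   the Gram matrix cancels the inverse that raises their index. *)
pose L : 'cV[R]_n := \col_l (2^-1 * \sum_i \sum_j w 0 i * y 0 j *
  (partial i (fun q => g q j l) p + partial j (fun q => g q i l) p
   - partial l (fun q => g q i j) p)).
have nablaE : nabla g (fun=> w) (fun=> y) p = (invmx (g p) *m L)^T.
  apply/rowP => k; rewrite /nabla !mxE.
  rewrite [X in X + _](_ : _ = 0) ?add0r; last exact: (derive_cst (V := 'rV[R]_n) (y 0 k)).
  under eq_bigr => i _ do under eq_bigr => j _ do
    rewrite /christoffel mulr_sumr !mulr_suml.
  under eq_bigr => i _ do rewrite exchange_big /=.
  rewrite exchange_big /=; apply: eq_bigr => l _; rewrite !mxE mulrCA !mulr_sumr.
  apply: eq_bigr => i _; rewrite !mulr_sumr; apply: eq_bigr => j _; ring.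
rewrite innerC /inner nablaE trmxK mulmxA mulmxK; last exact: metric_unit.
rewrite mxE /koszul !derive_inner_partial.
rewrite [X in _ + X - _]exchange_big /=.
rewrite [X in _ - X](_ : _ = \sum_i \sum_j \sum_l
   x 0 l * w 0 i * y 0 j * partial l (fun q => g q i j) p); last first.
  by rewrite exchange_big /=; apply: eq_bigr => i _; rewrite exchange_big.
rewrite -big_split -sumrB mulr_sumr /=.
under eq_bigr => l _ do rewrite !mxE mulrCA !mulr_sumr.
rewrite exchange_big; apply: eq_bigr => i _ /=.
rewrite -big_split -sumrB mulr_sumr /=.
under eq_bigr => l _ do rewrite !mulr_sumr.
rewrite exchange_big; apply: eq_bigr => j _ /=.
rewrite -big_split -sumrB mulr_sumr /=.
by apply: eq_bigr => l _; ring.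
Qed.

(** This is torsion-freeness, since constant fields commute; [koszul_compat] is compatibility with
    the metric. *)
Lemma koszulC w y x p : koszul w y x p = koszul y w x p.
Proof.
rewrite /koszul [X in _ * (X - _)]addrC; congr (_ * (_ - _)).
by congr ('D_x _ p); apply/funext => q; rewrite innerC.
Qed.

Lemma koszul_compat w y x p :
  koszul w y x p + koszul w x y p = 'D_w (fun q => inner g q y x) p.
Proof.
rewrite /koszul (_ : (fun q => inner g q x y) = (fun q => inner g q y x)).
  by field.
by apply/funext => q; rewrite innerC.
Qed.

Lemma nabla_const_derivable w y p v k :
  derivable (fun q => nabla g (fun=> w) (fun=> y) q 0 k) p v.
Proof.
rewrite (_ : (fun q => _) = fun q => \sum_i \sum_j
   christoffel g k i j q * w 0 i * y 0 j); last first.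
  apply/funext => q; rewrite /nabla !mxE.
  by rewrite [X in X + _](_ : _ = 0) ?add0r //; exact: (derive_cst (V := 'rV[R]_n) (y 0 k)).
apply: derivable_sum_fun => i; apply: derivable_sum_fun => j.
do 2 apply: derivable_mulr_fun; apply: derivable_mull_fun.
apply: derivable_sum_fun => l; apply: derivable_mul_fun.
  apply: derivable_invmx; [exact: metric_unit | by move=> *; exact: metric_derivable].
have dp a b c : derivable (partial a (fun q => g q b c)) p v.
  by apply: diff_derivable; case: hg => /(_ b c 2%N) [_ /(_ (delta_mx 0 a))] [d _].
apply: derivableB; last exact: dp.
by apply: derivableD; exact: dp.
Qed.

Lemma inner_nabla w (Y : 'rV[R]_n -> 'rV[R]_n) x p :
  (forall k, derivable (fun q => Y q 0 k) p w) ->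
  inner g p (nabla g (fun=> w) Y p) x =
  'D_w (fun q => inner g q (Y q) x) p
  - inner g p (Y p) (nabla g (fun=> w) (fun=> x) p).
Proof.
move=> dY.
(* A varying field contributes its directional derivative plus the covariant derivative of the
   constant field frozen at its value at [p]. *)
have nablaE : nabla g (fun=> w) Y p =
    dirD Y p w + nabla g (fun=> w) (fun=> Y p) p.
  rewrite /nabla; congr (_ + _); apply/rowP => k; rewrite !mxE.
  rewrite [X in _ = X + _](_ : _ = 0) ?add0r //.
  exact: (derive_cst (V := 'rV[R]_n) (Y p 0 k)).
have dx (k : 'I_n) : derivable (fun=> x 0 k) p w by exact: (derivable_cst (x 0 k)).
have dx0 : dirD (fun=> x) p w = 0.
  by apply/rowP => k; rewrite !mxE; exact: (derive_cst (V := 'rV[R]_n) (x 0 k)).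
have [_ ->] := is_derive_inner dY dx.
have [_ <-] := is_derive_inner_const p w (Y p) x.
rewrite nablaE innerDl dx0 (innerC p (Y p) 0) inner0l (innerC p (Y p)).
rewrite !inner_nabla_const -koszul_compat; ring.
Qed.

Lemma nabla0 (Y : 'rV[R]_n -> 'rV[R]_n) p : nabla g (fun=> 0) Y p = 0.
Proof.
apply/rowP => k; rewrite !mxE derive0 add0r big1 // => i _.
by rewrite big1 // => j _; rewrite mxE mulr0 mul0r.
Qed.

(** Metric compatibility moves the outer derivative from nabla_w y onto the scalar <nabla_w y, x>.
    So the Christoffel symbols need only be derivable, and their derivatives are never computed. *)
Lemma curvature_koszul p x y z w :
  curvature g p x y z w =
  'D_z (koszul w y x) p - 'D_w (koszul z y x) p
  - inner g p (nabla g (fun=> w) (fun=> y) p) (nabla g (fun=> z) (fun=> x) p)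
  + inner g p (nabla g (fun=> z) (fun=> y) p) (nabla g (fun=> w) (fun=> x) p).
Proof.
have br0 : lie_bracket (fun=> z) (fun=> w) = fun=> 0 :> 'rV[R]_n.
  apply/funext => q; rewrite /lie_bracket.
  by apply/rowP => k; rewrite !mxE !(derive_cst (V := 'rV[R]_n)) subr0.
rewrite /curvature /curvature_fields br0 nabla0 subr0.
rewrite innerDl -scaleN1r innerZl.
rewrite (inner_nabla (Y := nabla g (fun=> w) (fun=> y))); last first.
  by move=> k; exact: nabla_const_derivable.
rewrite (inner_nabla (Y := nabla g (fun=> z) (fun=> y))); last first.
  by move=> k; exact: nabla_const_derivable.
have E u : (fun q => inner g q (nabla g (fun=> u) (fun=> y) q) x) = koszul u y x.
  by apply/funext => q; rewrite inner_nabla_const.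
rewrite (E w) (E z).
move: ('D_z _ p) ('D_w _ p) (inner _ _ _ _) (inner _ _ _ _) => ? ? ? ?; ring.
Qed.

End MetricCalculus.

(** * Jets of the profile functions at r = 0 *)

Section RightLimits.
Local Open Scope classical_set_scope.
Variables (R : realType).

Lemma cvg_right_eq (f h : R -> R) (l : R) :
  (forall t, 0 < t -> f t = h t) -> h t @[t --> 0^'+] --> l ->
  f t @[t --> 0^'+] --> l.
Proof.
move=> fh; apply: cvg_trans; apply: near_eq_cvg; near=> t; apply/esym/fh.
by near: t; exact: nbhs_right_gt.
Unshelve. all: by end_near. Qed.

Lemma cvg_right_unique (f : R -> R) (k l : R) :
  f t @[t --> 0^'+] --> k -> f t @[t --> 0^'+] --> l -> k = l.
Proof. by move=> /(cvg_lim (@Rhausdorff R)) <- /(cvg_lim (@Rhausdorff R)) <-. Qed.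

(** Derivability supplies the two-sided limit, which a limit from the right then identifies; the
    polar form of the metric is available for t > 0 only. *)
Lemma derive_right_lim (V : normedModType R) (f : V -> R) (p v : V) (l : R) :
  derivable f p v -> (f (t *: v + p) - f p) / t @[t --> 0^'+] --> l ->
  'D_v f p = l.
Proof.
move=> df; apply: cvg_right_unique.
have : h^-1 *: (f (h *: v + p) - f p) @[h --> 0^'] --> 'D_v f p by exact: df.
move/cvg_dnbhs_at_right; apply: cvg_trans; apply: near_eq_cvg.
by near=> t; rewrite /GRing.scale /= mulrC.
Unshelve. all: by end_near. Qed.

Lemma cvg_right_line (V : normedModType R) (f : V -> R) (p v : V) :
  {for p, continuous f} -> f (t *: v + p) @[t --> 0^'+] --> f p.
Proof.
move=> cf; apply: (@cvg_comp _ _ _ (fun t : R => t *: v + p) f _ (nbhs p)); last exact: cf.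
have c0 : {for (0 : R), continuous (fun t : R => t *: v + p)}.
  by apply: cvgD; [apply: cvgZr_tmp; exact: cvg_id | exact: cvg_cst].
have := cvg_at_right_filter c0.
by rewrite /= scale0r add0r.
Qed.

Lemma cvg_right_id : (t : R) @[t --> 0^'+] --> (0 : R).
Proof. by apply: cvg_at_right_filter; exact: cvg_id. Qed.

Lemma cvg_right_of_quotient (f : R -> R) (k l : R) :
  (f t - k) / t @[t --> 0^'+] --> l -> f t @[t --> 0^'+] --> k.
Proof.
move=> fl; have := cvgD (cvgM fl cvg_right_id) (cvg_cst k).
rewrite mulr0 add0r => h.
apply: (@cvg_right_eq _ (fun t => (f t - k) / t * t + k)) => [t t0|]; last exact: h.
by rewrite mulfVK ?gt_eqF // subrK.
Qed.

(** The derivative at 0 of the smooth extension is obtained twice: from the difference quotient and,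
    by continuity, as the limit of the right-hand side of a differential equation. Comparing the two
    yields equations for [l]. *)
Lemma half_line_jet (f : R -> R) : smooth_on_half_line f ->
  exists l : R, [/\ (f t - f 0) / t @[t --> 0^'+] --> l &
    forall df : R -> R, (forall r : R, 0 < r -> is_derive r 1 f (df r)) ->
      df r @[r --> 0^'+] --> l].
Proof.
move=> [F [sF fF]]; exists ('D_1 F 0).
have [dF cF] : (forall p, differentiable F p) /\ forall v, continuous ('D_v F : R^o -> R).
  exact: (sF 1%N).
split=> [|df hdf].
  have : h^-1 *: (F (h *: 1 + 0) - F 0) @[h --> 0^'] --> 'D_1 F 0.
    exact: (diff_derivable (dF 0)).
  move/cvg_dnbhs_at_right; apply: cvg_trans; apply: near_eq_cvg.
  near=> h; have h0 : 0 <= h by apply: ltW; near: h; exact: nbhs_right_gt.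
  by rewrite !fF // /GRing.scale /= mulr1 addr0 mulrC.
have dfE r : 0 < r -> df r = 'D_1 F r.
  move=> r0; have [_ <-] := hdf _ r0; apply: near_eq_derive; near=> x.
  rewrite fF //; apply: ltW; near: x; exact: lt_nbhsr.
apply: (cvg_right_eq dfE); apply: cvg_at_right_filter.
exact: (cF 1 0).
Unshelve. all: by end_near. Qed.

End RightLimits.

(** * One-sided jets of a, b, c forced by the differential equations *)

Section Profile.
Local Open Scope classical_set_scope.
Variables (R : realType) (m : R) (a b c : R -> R).
Hypotheses (hm : 0 < m) (habc : AH_profile m a b c).

Definition ode_a (r : R) : R := (a r ^+ 2 - (b r - c r) ^+ 2) / (2 * b r * c r).
Definition ode_b (r : R) : R := (b r ^+ 2 - (c r - a r) ^+ 2) / (2 * c r * a r).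
Definition ode_c (r : R) : R := (c r ^+ 2 - (a r - b r) ^+ 2) / (2 * a r * b r).

Lemma profile_is_derive (r : R) : 0 < r ->
  [/\ is_derive r 1 a (ode_a r), is_derive r 1 b (ode_b r) & is_derive r 1 c (ode_c r)].
Proof. by case: habc => _ _ _; exact. Qed.

Lemma profile_neq0 (r : R) : 0 < r -> [/\ a r != 0, b r != 0 & c r != 0].
Proof.
case: habc => _ _ sgn _ r0; have [ar br cr] := sgn _ r0.
by split; [rewrite gt_eqF|rewrite lt_eqF|rewrite gt_eqF].
Qed.

Lemma profile_cvg : [/\ a r @[r --> 0^'+] --> (0 : R), b r @[r --> 0^'+] --> - m &
  c r @[r --> 0^'+] --> m].
Proof.
case: habc => [[sa sb sc] [a0 b0 c0] _ _]; split.
- by have [? [/cvg_right_of_quotient + _]] := half_line_jet sa; rewrite a0.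
- by have [? [/cvg_right_of_quotient + _]] := half_line_jet sb; rewrite b0.
- by have [? [/cvg_right_of_quotient + _]] := half_line_jet sc; rewrite c0.
Qed.

(** The equation for a' is regular at 0 and gives 2. Those for b' and c' are of the form 0/0;
    dividing numerator and denominator by r turns them into a linear system for b'(0) and c'(0). *)
Lemma profile_jet : [/\ a r / r @[r --> 0^'+] --> (2 : R),
  (b r + m) / r @[r --> 0^'+] --> (2^-1 : R) &
  (c r - m) / r @[r --> 0^'+] --> (2^-1 : R)].
Proof.
case: habc => [[sa sb sc] [a0 b0 c0] sgn ode].
have [al [ua da]] := half_line_jet sa.
have [be [ub db]] := half_line_jet sb.
have [ga [uc dc]] := half_line_jet sc.
have {}da := da ode_a (fun r r0 => let: And3 h _ _ := ode r r0 in h).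
have {}db := db ode_b (fun r r0 => let: And3 _ h _ := ode r r0 in h).
have {}dc := dc ode_c (fun r r0 => let: And3 _ _ h := ode r r0 in h).
rewrite a0 b0 c0 opprK in ua ub uc.
have {}ua : a r / r @[r --> 0^'+] --> al.
  by apply: cvg_trans ua; apply: near_eq_cvg; near=> t; rewrite subr0.
have [ca cb cc] := profile_cvg.
have m0 : m != 0 by rewrite gt_eqF.
have al2 : al = 2.
  apply: (cvg_right_unique da).
  rewrite (_ : 2 = (0 ^+ 2 - (- m - m) ^+ 2) / (2 * - m * m)); last by field.
  apply: cvgM.
    by apply: cvgB; [exact: cvgM|apply: cvgM; exact: cvgB].
  apply: cvgV; first by rewrite !mulf_neq0 ?oppr_eq0 ?pnatr_eq0.
  by apply: cvgM => //; apply: cvgM => //; exact: cvg_cst.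
have al0 : al != 0 by rewrite al2 pnatr_eq0.
(* The numerator b^2 - (c - a)^2 factors as (b - c + a)(b + c - a); only the second factor vanishes
   at 0, to first order like the denominator. *)
have beE : be = (- m - m + 0) * (be + ga - al) / (2 * m * al).
  apply: (cvg_right_unique db).
  apply: (@cvg_right_eq _ _ (fun r => (b r - c r + a r) *
      ((b r + m) / r + (c r - m) / r - a r / r) / (2 * c r * (a r / r)))).
    move=> r r0; have [? ? ?] := profile_neq0 r0; rewrite /ode_b; field.
    by apply/and3P; split=> //; rewrite gt_eqF.
  apply: cvgM.
    apply: cvgM; first by apply: cvgD => //; exact: cvgB.
    by apply: cvgB => //; exact: cvgD.
  apply: cvgV; first by rewrite !mulf_neq0 ?pnatr_eq0.
  by apply: cvgM => //; apply: cvgM => //; exact: cvg_cst.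
have gaE : ga = (be + ga - al) * (m + 0 - - m) / (2 * al * - m).
  apply: (cvg_right_unique dc).
  apply: (@cvg_right_eq _ _ (fun r => 
      ((b r + m) / r + (c r - m) / r - a r / r) * (c r + a r - b r)
      / (2 * (a r / r) * b r))).
    move=> r r0; have [? ? ?] := profile_neq0 r0; rewrite /ode_c; field.
    by apply/and3P; split=> //; rewrite gt_eqF.
  apply: cvgM.
    apply: cvgM; first by apply: cvgB => //; exact: cvgD.
    by apply: cvgB => //; exact: cvgD.
  apply: cvgV; first by rewrite !mulf_neq0 ?oppr_eq0 ?pnatr_eq0.
  by apply: cvgM => //; apply: cvgM => //; exact: cvg_cst.
rewrite al2 in beE gaE ua.
have e1 : be = - (be + ga - 2) / 2 by rewrite {1}beE; field.
have e2 : ga = - (be + ga - 2) / 2 by rewrite {1}gaE; field.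
have be2 : be = 2^-1 by lra.
have ga2 : ga = 2^-1 by lra.
by rewrite -{1}be2 -ga2.
Unshelve. all: by end_near. Qed.

(** Here b - c tends to -2m while (b + c)/r tends to 1. This slope is the source of the second
    fundamental form. *)
Lemma profile_diff : (b r ^+ 2 - c r ^+ 2) / 2 / r @[r --> 0^'+] --> - m.
Proof.
have [ua ub uc] := profile_jet; have [ca cb cc] := profile_cvg.
rewrite (_ : - m = (- m - m) * (2^-1 + 2^-1) * 2^-1); last by field.
apply: (@cvg_right_eq _ _ (fun r =>
   (b r - c r) * ((b r + m) / r + (c r - m) / r) * 2^-1)).
  by move=> r r0; field; rewrite gt_eqF.
by apply: cvgM; [apply: cvgM; [exact: cvgB|exact: cvgD]|exact: cvg_cst].
Qed.

(** The slopes -m of b^2 and m of c^2 cancel. *)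
Lemma profile_sum :
  ((b r ^+ 2 + c r ^+ 2) / 2 - m ^+ 2) / r @[r --> 0^'+] --> (0 : R).
Proof.
have [ua ub uc] := profile_jet; have [ca cb cc] := profile_cvg.
have h : ((b r + m) / r * (b r - m) + (c r - m) / r * (c r + m)) * 2^-1
    @[r --> 0^'+] --> (2^-1 * (- m - m) + 2^-1 * (m + m)) * 2^-1.
  apply: cvgM; last exact: cvg_cst.
  apply: cvgD; apply: cvgM => //; first by apply: cvgB => //; exact: cvg_cst.
  by apply: cvgD => //; exact: cvg_cst.
rewrite (_ : (2^-1 * (- m - m) + 2^-1 * (m + m)) * 2^-1 = 0) in h; last by field.
by apply: (cvg_right_eq _ h) => r r0; field; rewrite gt_eqF.
Qed.

(* (b^2 + c^2)/2 = m^2 + r^2 + o(r^2); by the equations for b' and c', only the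
   first-order jets of a, b, c enter. *)
Lemma profile_sum_derive :
  (b r * ode_b r + c r * ode_c r) / r @[r --> 0^'+] --> (2 : R).
Proof.
have [ua ub uc] := profile_jet; have [ca cb cc] := profile_cvg.
have m0 : m != 0 by rewrite gt_eqF.
rewrite (_ : 2 = ((- m - m) * (2^-1 + 2^-1)) ^+ 2 / (2 * (- m * m) * 2)
    - 2 * ((- m) ^+ 2 + m ^+ 2) / (2 * (- m * m)) + (2^-1 + 2^-1)); last by field.
(* Expanding gives b b' + c c' = (b^2 - c^2)^2 / (2abc) - a (b^2 + c^2) / (2bc) + b + c. After
   division by r the three terms tend to -1, 2 and 1. *)
apply: (@cvg_right_eq _ _ (fun r =>
    ((b r - c r) * ((b r + m) / r + (c r - m) / r)) ^+ 2
       / (2 * (b r * c r) * (a r / r))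
    - a r / r * (b r ^+ 2 + c r ^+ 2) / (2 * (b r * c r))
    + ((b r + m) / r + (c r - m) / r))).
  move=> r r0; have [? ? ?] := profile_neq0 r0; rewrite /ode_b /ode_c; field.
  by do ?[apply/andP; split] => //; rewrite gt_eqF.
have cbc : 2 * (b r * c r) @[r --> 0^'+] --> 2 * (- m * m).
  by apply: cvgM; [exact: cvg_cst|exact: cvgM].
have cvw : (b r + m) / r + (c r - m) / r @[r --> 0^'+] --> (2^-1 + 2^-1 : R).
  exact: cvgD.
have cq : (b r - c r) * ((b r + m) / r + (c r - m) / r) @[r --> 0^'+] -->
    (- m - m) * (2^-1 + 2^-1) by apply: cvgM => //; exact: cvgB.
apply: cvgD => //; apply: cvgB.
  apply: cvgM; first exact: cvgM.
  apply: cvgV; first by rewrite !mulf_neq0 ?oppr_eq0 ?pnatr_eq0.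
  exact: cvgM.
apply: cvgM; first by apply: cvgM => //; apply: cvgD; exact: cvgM.
by apply: cvgV => //; rewrite !mulf_neq0 ?oppr_eq0 ?pnatr_eq0.
Qed.

Lemma profile_a_derive : a r * ode_a r / r @[r --> 0^'+] --> (4 : R).
Proof.
have [ua ub uc] := profile_jet; have [ca cb cc] := profile_cvg.
have m0 : m != 0 by rewrite gt_eqF.
rewrite (_ : 4 = 2 * ((0 ^+ 2 - (- m - m) ^+ 2) / (2 * - m * m))); last by field.
apply: (@cvg_right_eq _ _ (fun r => a r / r * ode_a r)).
  by move=> r r0; rewrite mulrAC.
apply: cvgM => //; apply: cvgM.
  by apply: cvgB; [exact: cvgM|apply: cvgM; exact: cvgB].
apply: cvgV; first by rewrite !mulf_neq0 ?oppr_eq0 ?pnatr_eq0.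
by apply: cvgM => //; apply: cvgM => //; exact: cvg_cst.
Qed.

(** The trace of the tangential metric at distance [r] on a fiber; [C] stands for the sum of the
    squares of [connection] over the tangent frame. *)
Definition radial (C : R) (r : R) : R :=
  4 * a r ^+ 2 * C + (b r ^+ 2 + c r ^+ 2) / m ^+ 2.

Definition radial' (C : R) (r : R) : R :=
  8 * (a r * ode_a r) * C + 2 * (b r * ode_b r + c r * ode_c r) / m ^+ 2.

Lemma is_derive_radial (C r : R) : 0 < r -> is_derive r 1 (radial C) (radial' C r).
Proof.
move=> r0; have [da db dc] := profile_is_derive r0.
rewrite /radial (_ : (fun r => _) = (fun r =>
   (4 * C) * (a r * a r) + m ^- 2 * (b r * b r + c r * c r))); last first.
  by apply/funext => x; ring.
apply: is_derive_eq.
rewrite /radial' /GRing.scale /=; ring.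
Qed.

Lemma radial'_cvg (C : R) :
  radial' C r / r @[r --> 0^'+] --> 32 * C + 4 / m ^+ 2.
Proof.
rewrite (_ : 32 * C + 4 / m ^+ 2 = 8 * C * 4 + 2 / m ^+ 2 * 2); last by ring.
apply: (@cvg_right_eq _ _ (fun r => 8 * C * (a r * ode_a r / r) +
   2 / m ^+ 2 * ((b r * ode_b r + c r * ode_c r) / r))).
  move=> r r0; rewrite /radial'; ring.
apply: cvgD; apply: cvgM; try exact: cvg_cst.
  exact: profile_a_derive.
exact: profile_sum_derive.
Qed.

End Profile.

(** * Strong stability from the polar form of the metric *)

Section DerivativesAlongLines.
Local Open Scope classical_set_scope.
Variables (R : realType) (V : normedModType R).

Lemma derive_along_line (f : V -> R) (phi : R -> R) (p v : V) (t d : R) :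
  (\forall h \near (0 : R), f (h *: v + p) = phi (h + t)) ->
  is_derive t 1 phi d -> 'D_v f p = d.
Proof.
move=> fphi [dphi <-]; apply: cvg_lim => //.
have : h^-1 *: ((phi \o shift t) (h *: (1 : R)) - phi t) @[h --> 0^'] --> 'D_1 phi t.
  exact: dphi.
apply: cvg_trans; apply: near_eq_cvg.
have fp0 : f p = phi t by have := nbhs_singleton fphi; rewrite scale0r !add0r.
near=> h; rewrite /= fp0 [h *: (1 : R)]mulr1.
have /= -> // : f (h *: v + p) = phi (h + t).
near: h; exact: nbhs_dnbhs.
Unshelve. all: by end_near. Qed.

Lemma derive_even (f : V -> R) (p v : V) : differentiable f p ->
  (forall h : R, f (h *: v + p) = f (- h *: v + p)) -> 'D_v f p = 0.
Proof.
move=> df ev.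
have dN : 'D_(- v) f p = - 'D_v f p by rewrite !deriveE // linearN.
have dE : 'D_(- v) f p = 'D_v f p.
  rewrite /derive (_ : (fun h => h^-1 *: ((f \o shift p) (h *: - v) - f p)) =
    (fun h => h^-1 *: ((f \o shift p) (h *: v) - f p))) //.
  by apply/funext => h /=; rewrite scalerN -scaleNr ev opprK.
by rewrite dE in dN; lra.
Qed.

End DerivativesAlongLines.

Lemma sum_ord2 (V : zmodType) (F : 'I_2 -> V) : \sum_(i < 2) F i = F 0 + F 1.
Proof.
rewrite big_ord_recl big_ord1; congr (F _ + F _); exact/val_inj.
Qed.

(** For a 2 by 2 matrix, M M^T = k I with k nonzero forces M^T M = k I. The column relations are
    what contracts sums over a frame. *)
Lemma columns_orthonormal (R : realType) (k x y x' y' : R) : k != 0 ->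
  x * x + y * y = k -> x' * x' + y' * y' = k -> x * x' + y * y' = 0 ->
  [/\ x * x + x' * x' = k, y * y + y' * y' = k & x * y + x' * y' = 0].
Proof.
move=> k0 h1 h2 h3.
have e1 : x * x + x' * x' = k.
  apply: (mulfI k0).
  (* Since x x' = - y y', the squares of both sides agree; expanding leaves k (k - x^2 - x'^2) =
     0. *)
  have e : (x * x) * (x' * x') = (k - x * x) * (k - x' * x').
    rewrite -{1}h1 -h2; have -> : x * x * (x' * x') = (x * x') ^+ 2 by ring.
    rewrite (_ : x * x' = - (y * y')); last by apply/eqP; rewrite -addr_eq0 h3.
    ring.
  apply/eqP; rewrite -subr_eq0; apply/eqP.
  transitivity (x * x * (x' * x') - (k - x * x) * (k - x' * x')); first by ring.
  by rewrite e subrr.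
split=> //; first by lra.
apply: (mulfI k0); rewrite mulr0.
transitivity ((x * x' + y * y') * (x * y' + x' * y)); last by rewrite h3 mul0r.
by rewrite mulrDr -{1}h2 -h1; ring.
Qed.

(** * Real coordinates and the polar normal form of the metric *)

Section Coordinates.
Local Open Scope classical_set_scope.
Variable R : realType.
Implicit Types (n p s v w : 'rV[R]_(2 + 2)).

Definition zre v : R := lsubmx v 0 0.
Definition zim v : R := lsubmx v 0 1.
Definition fre v : R := rsubmx v 0 0.
Definition fim v : R := rsubmx v 0 1.

Definition vertical v : Prop := lsubmx v = 0.

Definition base_dot v w : R := zre v * zre w + zim v * zim w.
Definition fiber_dot v w : R := fre v * fre w + fim v * fim w.
Definition fiber_cross v w : R := fre v * fim w - fim v * fre w.
(* Re (n v w) for the fiber component of n and the base components of v, w *)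
Definition twist n v w : R :=
  fre n * (zre v * zre w - zim v * zim w) - fim n * (zre v * zim w + zim v * zre w).
Definition conformal p : R := 4 / (1 + zre p ^+ 2 + zim p ^+ 2) ^+ 2.
(* Im (conj z dz) / (1 + |z|^2), so that sigma1 = dpsi / 2 + 2 * connection *)
Definition connection p v : R :=
  (zre p * zim v - zim p * zre v) / (1 + zre p ^+ 2 + zim p ^+ 2).

(* The polarization of ds2 at the point s + t n of the fiber over s, where n is
   a unit fiber vector and t = r. *)
Definition polar_form (a b c : R -> R) (t : R) n s v w : R :=
  fiber_dot n v * fiber_dot n w +
  (a t / t / 2) ^+ 2 * (fiber_cross n v + 4 * t * connection s v)
                     * (fiber_cross n w + 4 * t * connection s w) +
  conformal s * ((b t ^+ 2 + c t ^+ 2) / 2 * base_dot v w +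
                 (b t ^+ 2 - c t ^+ 2) / 2 * twist n v w).

(** The chart-independent property from which strong stability is derived; it is verified separately
    for each chart. *)
Definition polar_metric (a b c : R -> R) (g : 'rV[R]_(2 + 2) -> 'M[R]_(2 + 2)) :=
  forall s n v w (t : R), on_slice s -> vertical n -> fiber_dot n n = 1 ->
    0 < t -> inner g (t *: n + s) v w = polar_form a b c t n s v w.

Lemma conformal_gt0 p : 0 < conformal p.
Proof.
by rewrite /conformal divr_gt0 // exprn_gt0 // -addrA ltr_wpDr // addr_ge0 // sqr_ge0.
Qed.

Lemma tangent_fiber v : tangent v -> fre v = 0 /\ fim v = 0.
Proof. by rewrite /tangent /fre /fim => ->; rewrite !mxE. Qed.

Lemma vertical_base v : vertical v -> zre v = 0 /\ zim v = 0.
Proof. by rewrite /vertical /zre /zim => ->; rewrite !mxE. Qed.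

Lemma ord2_eq (i : 'I_2) : i = 0 \/ i = 1.
Proof. by case: i => [[|[|//]] h]; [left|right]; exact: val_inj. Qed.

Lemma vertical_coord v : zre v = 0 -> zim v = 0 -> vertical v.
Proof.
by move=> h0 h1; apply/rowP => i; rewrite [RHS]mxE; have [->|->] := ord2_eq i.
Qed.

End Coordinates.

(** * First-order jet of the metric along the zero section *)

Section StrongStability.
Local Open Scope classical_set_scope.
Variables (R : realType) (m : R) (a b c : R -> R).
Variable g : 'rV[R]_(2 + 2) -> 'M[R]_(2 + 2).
Hypotheses (hm : 0 < m) (habc : AH_profile m a b c).
Hypotheses (hg : riemannian_metric g) (hpol : polar_metric a b c g).
Implicit Types (n p s v w e : 'rV[R]_(2 + 2)).

Let m0 : m != 0. Proof. by rewrite gt_eqF. Qed.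

(** By continuity the metric at [s] is the limit of the polar form along any one ray. As a(t)/t
    tends to 2, the fiber part becomes Euclidean. *)
Lemma slice_metric s v w : on_slice s ->
  inner g s v w = fiber_dot v w + conformal s * m ^+ 2 * base_dot v w.
Proof.
move=> hs; pose n : 'rV[R]_(2 + 2) := row_mx 0 (delta_mx 0 0).
have vn : vertical n by rewrite /vertical row_mxKl.
have n1 : fre n = 1 by rewrite /fre row_mxKr mxE.
have n2 : fim n = 0 by rewrite /fim row_mxKr mxE.
have nn : fiber_dot n n = 1 by rewrite /fiber_dot n1 n2; ring.
have := cvg_right_line (p := s) n
  (differentiable_continuous (inner_differentiable hg v w s)).
move/cvg_right_unique; apply.
have [ua _ _] := profile_jet hm habc; have [_ cb cc] := profile_cvg habc.
apply: (@cvg_right_eq _ _ (fun t => polar_form a b c t n s v w)).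
  by move=> t t0; exact: hpol.
rewrite (_ : _ + _ = fiber_dot n v * fiber_dot n w +
  (2 / 2) ^+ 2 * (fiber_cross n v + 4 * 0 * connection s v)
               * (fiber_cross n w + 4 * 0 * connection s w) +
  conformal s * (((- m) ^+ 2 + m ^+ 2) / 2 * base_dot v w +
                 ((- m) ^+ 2 - m ^+ 2) / 2 * twist n v w)); last first.
  by rewrite /fiber_dot /fiber_cross n1 n2; field.
have cstep v' : fiber_cross n v' + 4 * t * connection s v' @[t --> 0^'+] -->
    fiber_cross n v' + 4 * 0 * connection s v'.
  apply: cvgD; first exact: cvg_cst.
  by do 2 (apply: cvgM; last exact: cvg_cst || exact: cvg_right_id); exact: cvg_cst.
have cstr (f h : R -> R) (k l : R) : f t @[t --> 0^'+] --> k -> 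
    f t / 2 * l @[t --> 0^'+] --> k / 2 * l.
  by move=> fk; do 2 (apply: cvgM; last exact: cvg_cst).
have sq (f : R -> R) (k : R) : f t @[t --> 0^'+] --> k ->
    f t ^+ 2 @[t --> 0^'+] --> k ^+ 2.
  by move=> fk; apply: cvgM.
rewrite /polar_form; apply: cvgD; last first.
  apply: cvgM; first exact: cvg_cst.
  apply: cvgD; (apply: cvgM; last exact: cvg_cst);
    (apply: cvgM; last exact: cvg_cst); [apply: cvgD|apply: cvgB]; exact: sq.
apply: cvgD; first exact: cvg_cst.
apply: cvgM; last exact: cstep.
apply: cvgM; last exact: cstep.
by apply: sq; apply: cvgM => //; exact: cvg_cst.
Qed.

(** The a-term is of second order in t on tangent vectors and (b^2 + c^2)/2 has no linear term, so
    only the slope -m of (b^2 - c^2)/2 survives. *)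
Lemma derive_normal_tangent s n e e' : on_slice s -> vertical n ->
  fiber_dot n n = 1 -> tangent e -> tangent e' ->
  'D_n (fun q => inner g q e e') s = - m * conformal s * twist n e e'.
Proof.
move=> hs vn nn te te'.
apply: derive_right_lim; first exact: inner_derivable.
have [e1 e2] := tangent_fiber te; have [e1' e2'] := tangent_fiber te'.
have [ua _ _] := profile_jet hm habc; have [ca _ _] := profile_cvg habc.
have sum0 := profile_sum hm habc; have dif := profile_diff hm habc.
apply: (@cvg_right_eq _ _ (fun t =>
   4 * connection s e * connection s e' * (a t * (a t / t)) +
   conformal s * (base_dot e e' * (((b t ^+ 2 + c t ^+ 2) / 2 - m ^+ 2) / t) +
                  twist n e e' * ((b t ^+ 2 - c t ^+ 2) / 2 / t)))).
  move=> t t0; rewrite hpol // slice_metric // /polar_form.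
  rewrite /fiber_dot /fiber_cross e1 e2 e1' e2'; field; by rewrite gt_eqF.
rewrite (_ : - m * _ * _ = 4 * connection s e * connection s e' * (0 * 2) +
   conformal s * (base_dot e e' * 0 + twist n e e' * - m)); last by ring.
apply: cvgD.
  by apply: cvgM; [exact: cvg_cst|exact: cvgM].
apply: cvgM; first exact: cvg_cst.
by apply: cvgD; apply: cvgM => //; exact: cvg_cst.
Qed.

(** This is the cross term of the square of sigma1; the 4 is the limit of (a(t)/t)^2. *)
Lemma derive_normal_mixed s n e v : on_slice s -> vertical n ->
  fiber_dot n n = 1 -> tangent e -> vertical v ->
  'D_n (fun q => inner g q e v) s = 4 * connection s e * fiber_cross n v.
Proof.
move=> hs vn nn te vv.
apply: derive_right_lim; first exact: inner_derivable.
have [e1 e2] := tangent_fiber te; have [v1 v2] := vertical_base vv.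
have [ua _ _] := profile_jet hm habc.
apply: (@cvg_right_eq _ _ (fun t =>
   connection s e * fiber_cross n v * (a t / t) ^+ 2)).
  move=> t t0; rewrite hpol // slice_metric // /polar_form.
  rewrite /fiber_dot /fiber_cross /base_dot /twist {2}/connection.
  rewrite e1 e2 v1 v2 /connection; field.
  by rewrite gt_eqF //= gt_eqF // -addrA ltr_wpDr // addr_ge0 // sqr_ge0.
rewrite (_ : 4 * _ * _ = connection s e * fiber_cross n v * 2 ^+ 2); last by ring.
by apply: cvgM; [exact: cvg_cst|exact: cvgM].
Qed.

Lemma derive_slice (f : 'rV[R]_(2 + 2) -> R) (k : R) s e : on_slice s ->
  tangent e -> (forall q, on_slice q -> f q = k) -> 'D_e f s = 0.
Proof.
move=> hs te fk; rewrite /derive.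
rewrite (_ : (fun h => _) = (fun=> 0)); first exact: lim_cst.
apply/funext => h /=; rewrite !fk ?subrr ?scaler0 // /on_slice.
by rewrite linearD linearZ /= te hs scaler0 addr0.
Qed.

Lemma derive_tangent_mixed s e e' v : on_slice s -> tangent e -> tangent e' ->
  vertical v -> 'D_e (fun q => inner g q e' v) s = 0.
Proof.
move=> hs te te' vv; apply: (@derive_slice _ 0) => // q hq.
have [e1 e2] := tangent_fiber te'; have [v1 v2] := vertical_base vv.
by rewrite slice_metric // /fiber_dot /base_dot e1 e2 v1 v2; ring.
Qed.

Lemma derive_tangent_normal s e v v' : on_slice s -> tangent e -> vertical v ->
  vertical v' -> 'D_e (fun q => inner g q v v') s = 0.
Proof.
move=> hs te vv vv'; apply: (@derive_slice _ (fiber_dot v v')) => // q hq.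
have [v1 v2] := vertical_base vv; have [v1' v2'] := vertical_base vv'.
by rewrite slice_metric // /base_dot v1 v2; ring.
Qed.

Let swap v w : (fun q => inner g q v w) = (fun q => inner g q w v).
Proof. by apply/funext => q; rewrite (innerC hg). Qed.

Lemma koszul_ttn s e e' v : on_slice s -> tangent e -> tangent e' ->
  vertical v -> fiber_dot v v = 1 ->
  koszul g e e' v s = 2^-1 * m * conformal s * twist v e e'.
Proof.
move=> hs te te' vv nv; rewrite /koszul.
rewrite (derive_tangent_mixed hs te te' vv) (derive_tangent_mixed hs te' te vv).
by rewrite derive_normal_tangent //; ring.
Qed.

Lemma koszul_tnt s e e' v : on_slice s -> tangent e -> tangent e' ->
  vertical v -> fiber_dot v v = 1 ->
  koszul g e v e' s = - (2^-1 * m * conformal s * twist v e e').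
Proof.
move=> hs te te' vv nv; rewrite /koszul (swap v e').
rewrite (derive_tangent_mixed hs te te' vv) (derive_tangent_mixed hs te' te vv).
by rewrite derive_normal_tangent //; ring.
Qed.

(** The normal connection acts by infinitesimal rotations of the fiber, hence through the
    antisymmetric [fiber_cross]. *)
Lemma koszul_tnn s e v v' : on_slice s -> tangent e -> vertical v ->
  vertical v' -> fiber_dot v v = 1 -> fiber_dot v' v' = 1 ->
  koszul g e v v' s = 4 * connection s e * fiber_cross v v'.
Proof.
move=> hs te vv vv' nv nv'; rewrite /koszul (derive_tangent_normal hs te vv vv').
by rewrite !derive_normal_mixed // /fiber_cross; field.
Qed.

(** The two mixed derivatives cancel by antisymmetry of [fiber_cross]: the fiber is totally geodesic
    at [s]. *)
Lemma koszul_nnt s e v v' : on_slice s -> tangent e -> vertical v ->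
  vertical v' -> fiber_dot v v = 1 -> fiber_dot v' v' = 1 ->
  koszul g v v' e s = 0.
Proof.
move=> hs te vv vv' nv nv'; rewrite /koszul (derive_tangent_normal hs te vv vv').
rewrite (swap v' e) (swap v e) !derive_normal_mixed // /fiber_cross; ring.
Qed.

(** * Contractions over an adapted frame and the trace of the curvature *)

Section Frame.
Variables (s : 'rV[R]_(2 + 2)) (e nu : 'I_2 -> 'rV[R]_(2 + 2)).
Hypotheses (hs : on_slice s) (fr : adapted_frame g s e nu).

Let E := conformal s.
(** The squared coordinate length of a unit tangent vector at [s]. *)
Let kap := (E * m ^+ 2)^-1.
Let E0 : E != 0. Proof. by rewrite gt_eqF // conformal_gt0. Qed.

Let te l : tangent (e l). Proof. by case: fr. Qed.

Lemma normal_vertical v : normal g s v -> vertical v.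
Proof.
(* The vector is tested against its own base part, whose length must then vanish. *)
move=> nv; pose w : 'rV[R]_(2 + 2) := row_mx (lsubmx v) 0.
have tw : tangent w by rewrite /tangent row_mxKr.
have [w1 w2] := tangent_fiber tw.
have := nv w tw; rewrite slice_metric // -/E /fiber_dot w1 w2 !mulr0 !add0r.
have Em0 : E * m ^+ 2 != 0 by rewrite mulf_neq0 // expf_neq0.
move=> /eqP; rewrite mulf_eq0 (negbTE Em0) /=.
have -> : base_dot v w = zre v ^+ 2 + zim v ^+ 2.
  by rewrite /base_dot /zre /zim row_mxKl; ring.
rewrite paddr_eq0 ?sqr_ge0 // !sqrf_eq0 => /andP[/eqP h1 /eqP h2].
exact: vertical_coord.
Qed.

Let vnu mu : vertical (nu mu).
Proof. by apply: normal_vertical; case: fr. Qed.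

Let dot_nu mu mu' : fiber_dot (nu mu) (nu mu') = (mu == mu')%:R.
Proof.
case: fr => _ _ _ <-; rewrite slice_metric //.
by have [h1 h2] := vertical_base (vnu mu); rewrite /base_dot h1 h2; ring.
Qed.

Let nnu mu : fiber_dot (nu mu) (nu mu) = 1. Proof. by rewrite dot_nu eqxx. Qed.

Let dot_e l k : base_dot (e l) (e k) = kap * (l == k)%:R.
Proof.
case: fr => _ _ <- _; rewrite slice_metric //.
have [h1 h2] := tangent_fiber (te l); rewrite /fiber_dot h1 h2 /kap -/E.
by field; rewrite E0 m0.
Qed.

Let kap0 : kap != 0. Proof. by rewrite invr_eq0 mulf_neq0 // expf_neq0. Qed.

Let cols_e : [/\ zre (e 0) * zre (e 0) + zre (e 1) * zre (e 1) = kap,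
  zim (e 0) * zim (e 0) + zim (e 1) * zim (e 1) = kap &
  zre (e 0) * zim (e 0) + zre (e 1) * zim (e 1) = 0].
Proof.
apply: columns_orthonormal => //.
- by have := dot_e 0 0; rewrite eqxx mulr1.
- by have := dot_e 1 1; rewrite eqxx mulr1.
- by have := dot_e 0 1; rewrite mulr0.
Qed.

Let cols_nu : [/\ fre (nu 0) * fre (nu 0) + fre (nu 1) * fre (nu 1) = 1,
  fim (nu 0) * fim (nu 0) + fim (nu 1) * fim (nu 1) = 1 &
  fre (nu 0) * fim (nu 0) + fre (nu 1) * fim (nu 1) = 0].
Proof.
apply: columns_orthonormal; first exact: oner_neq0.
- by have := dot_nu 0 0.
- by have := dot_nu 1 1.
- by have := dot_nu 0 1.
Qed.

(** Completeness of the frame follows from the column relations. It reduces the products of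
    covariant derivatives in the curvature to Koszul terms. *)
Lemma frame_parseval v w : inner g s v w =
  \sum_(l < 2) inner g s v (e l) * inner g s w (e l) +
  \sum_(mu < 2) inner g s v (nu mu) * inner g s w (nu mu).
Proof.
have [x y xy] := cols_e; have [x' y' xy'] := cols_nu.
rewrite !sum_ord2 !slice_metric // -/E /fiber_dot /base_dot.
have [-> ->] := tangent_fiber (te 0); have [-> ->] := tangent_fiber (te 1).
have [-> ->] := vertical_base (vnu 0); have [-> ->] := vertical_base (vnu 1).
transitivity (
  (E * m ^+ 2) ^+ 2 *
   (zre v * zre w * (zre (e 0) * zre (e 0) + zre (e 1) * zre (e 1)) +
    zim v * zim w * (zim (e 0) * zim (e 0) + zim (e 1) * zim (e 1)) +
    (zre v * zim w + zim v * zre w) * (zre (e 0) * zim (e 0) + zre (e 1) * zim (e 1))) +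
   (fre v * fre w * (fre (nu 0) * fre (nu 0) + fre (nu 1) * fre (nu 1)) +
    fim v * fim w * (fim (nu 0) * fim (nu 0) + fim (nu 1) * fim (nu 1)) +
    (fre v * fim w + fim v * fre w) *
      (fre (nu 0) * fim (nu 0) + fre (nu 1) * fim (nu 1)))); last by ring.
rewrite x y xy x' y' xy' /kap; field; by rewrite E0 m0.
Qed.

(** The real part of a complex bilinear form on C is trace-free for the Euclidean metric, to which
    the frame is conformal. *)
Lemma twist_trace v : \sum_(l < 2) twist v (e l) (e l) = 0.
Proof.
have [x y xy] := cols_e; rewrite sum_ord2 /twist.
transitivity (fre v * ((zre (e 0) * zre (e 0) + zre (e 1) * zre (e 1)) -
   (zim (e 0) * zim (e 0) + zim (e 1) * zim (e 1))) -
   2 * fim v * (zre (e 0) * zim (e 0) + zre (e 1) * zim (e 1))); first by ring.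
by rewrite x y xy; ring.
Qed.

(** In standard coordinates [twist v] is the symmetric trace-free matrix with rows (f, -g), (-g, -f)
    for the fiber components f, g of [v]; the claim is the Hilbert-Schmidt product of two such
    matrices. *)
Lemma twist_contraction v w :
  \sum_(l < 2) \sum_(k < 2) twist v (e l) (e k) * twist w (e l) (e k) =
  2 * kap ^+ 2 * fiber_dot v w.
Proof.
have [x y xy] := cols_e; rewrite !sum_ord2 /twist /fiber_dot.
set X := _ + _ in x; set Y := _ + _ in y; set Z := _ + _ in xy.
transitivity (fre v * fre w * (X ^+ 2 - 2 * Z ^+ 2 + Y ^+ 2)
  + fim v * fim w * (2 * X * Y + 2 * Z ^+ 2)
  - (fre v * fim w + fim v * fre w) * (2 * X * Z - 2 * Z * Y)).
  by rewrite /X /Y /Z; ring.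
by rewrite x y xy; ring.
Qed.

(** [fiber_cross] is the dot product after a quarter turn of its first argument, so this is Parseval
    for a rotated pair. *)
Lemma cross_contraction mu mu' :
  \sum_(rho < 2) fiber_cross (nu mu) (nu rho) * fiber_cross (nu mu') (nu rho)
  = (mu == mu')%:R.
Proof.
have [x y xy] := cols_nu; rewrite -dot_nu sum_ord2 /fiber_cross /fiber_dot.
set X := _ + _ in x; set Y := _ + _ in y; set Z := _ + _ in xy.
transitivity (fre (nu mu) * fre (nu mu') * Y + fim (nu mu) * fim (nu mu') * X
  - (fre (nu mu) * fim (nu mu') + fim (nu mu) * fre (nu mu')) * Z).
  by rewrite /X /Y /Z; ring.
by rewrite x y xy; ring.
Qed.

Let Phi q := \sum_(l < 2) inner g q (e l) (e l).
Let C := \sum_(l < 2) connection s (e l) ^+ 2.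

(** With the frame coefficients frozen at [s], the only term depending on the direction [n] is the
    twist, which the trace removes. *)
Lemma tangent_trace_polar n (t : R) : vertical n -> fiber_dot n n = 1 -> 0 < t ->
  Phi (t *: n + s) = radial m a b c C t.
Proof.
move=> vn nn t0; rewrite /Phi.
transitivity (\sum_(l < 2) (4 * a t ^+ 2 * connection s (e l) ^+ 2 +
   E * ((b t ^+ 2 + c t ^+ 2) / 2 * kap) +
   E * ((b t ^+ 2 - c t ^+ 2) / 2) * twist n (e l) (e l))).
  apply: eq_bigr => l _; rewrite hpol // /polar_form dot_e eqxx mulr1 -/E.
  have [h1 h2] := tangent_fiber (te l); rewrite /fiber_dot /fiber_cross h1 h2.
  by field; rewrite gt_eqF.
rewrite big_split /= -[X in _ + X]mulr_sumr twist_trace mulr0 addr0.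
rewrite big_split /= -mulr_sumr.
rewrite -/C sumr_const card_ord /radial -mulr_natl /kap.
by field; rewrite m0 E0.
Qed.

Lemma tangent_trace_differentiable q : differentiable Phi q.
Proof.
rewrite (_ : Phi = \sum_(l < 2) (fun q => inner g q (e l) (e l))).
  by apply: differentiable_sum => l; exact: inner_differentiable.
by apply/funext => p; rewrite fct_sumE.
Qed.

Lemma tangent_trace_derive v q :
  'D_v Phi q = \sum_(l < 2) 'D_v (fun q => inner g q (e l) (e l)) q.
Proof.
rewrite (_ : Phi = \sum_(l < 2) (fun q => inner g q (e l) (e l))).
  by apply: derive_sum => l; exact: inner_derivable.
by apply/funext => p; rewrite fct_sumE.
Qed.

Lemma tangent_trace_derivable2 v w q : derivable ('D_v Phi) q w.
Proof.
rewrite (_ : 'D_v Phi =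
    (fun q => \sum_(l < 2) 'D_v (fun q => inner g q (e l) (e l)) q)).
  by apply: derivable_sum_fun => l; exact: derive_inner_derivable.
by apply/funext => p; exact: tangent_trace_derive.
Qed.

Lemma tangent_trace_critical mu : 'D_(nu mu) Phi s = 0.
Proof.
rewrite tangent_trace_derive.
under eq_bigr => l _ do rewrite derive_normal_tangent //.
by rewrite -mulr_sumr twist_trace mulr0.
Qed.

(* On the fiber over s, Phi only depends on the distance to s. *)
Lemma tangent_trace_even mu mu' (t h : R) : mu != mu' -> 0 < t ->
  Phi (h *: nu mu + (t *: nu mu' + s)) = Phi (- h *: nu mu + (t *: nu mu' + s)).
Proof.
move=> mumu' t0.
have r0 : 0 < h ^+ 2 + t ^+ 2 by rewrite ltr_wpDl ?sqr_ge0 // exprn_gt0.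
(* Covers k = h and k = -h at once: the point lies at distance sqrt(h^2 + t^2) from [s], and the
   polar form applies in its own unit direction. *)
have rE k : k ^+ 2 = h ^+ 2 ->
    Phi (k *: nu mu + (t *: nu mu' + s)) = radial m a b c C (Num.sqrt (h ^+ 2 + t ^+ 2)).
  move=> kh; set r := Num.sqrt _.
  have rp : 0 < r by rewrite sqrtr_gt0.
  have r20 : r != 0 by rewrite gt_eqF.
  pose n := r^-1 *: (k *: nu mu + t *: nu mu').
  have fl v w (x y : R) : rsubmx (x *: v + y *: w) = x *: rsubmx v + y *: rsubmx w
      :> 'rV[R]_2.
    by rewrite linearD !linearZ.
  have vn : vertical n.
    by rewrite /vertical /n linearZ linearD !linearZ /= !vnu !scaler0 addr0 scaler0.
  have nn : fiber_dot n n = 1.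
    have fxn : fre n = r^-1 * (k * fre (nu mu) + t * fre (nu mu')).
      by rewrite /fre /n linearZ /= mxE fl !mxE.
    have fyn : fim n = r^-1 * (k * fim (nu mu) + t * fim (nu mu')).
      by rewrite /fim /n linearZ /= mxE fl !mxE.
    transitivity (r ^- 2 * (k ^+ 2 * fiber_dot (nu mu) (nu mu) +
        t ^+ 2 * fiber_dot (nu mu') (nu mu') +
        2 * k * t * fiber_dot (nu mu) (nu mu'))).
      by rewrite /fiber_dot fxn fyn; field.
    rewrite !nnu dot_nu (negbTE mumu') !mulr1 mulr0 addr0 kh.
    by rewrite sqr_sqrtr ?mulVf ?gt_eqF // ltW.
  rewrite -(tangent_trace_polar vn nn rp); congr Phi.
  by rewrite /n scalerA mulfV // scale1r addrA.
by rewrite !rE // sqrrN.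
Qed.

Lemma tangent_trace_hessian mu mu' :
  'D_(nu mu') ('D_(nu mu) Phi) s = (32 * C + 4 / m ^+ 2) * (mu == mu')%:R.
Proof.
apply: derive_right_lim; first exact: tangent_trace_derivable2.
rewrite tangent_trace_critical; have [<-|mumu'] := eqVneq mu mu'.
  (* On the diagonal the first derivative is taken along the ray itself, where it is [radial']. *)
  rewrite mulr1; apply: (cvg_right_eq _ (radial'_cvg hm habc (C := C))) => t t0.
  rewrite subr0; congr (_ / _).
  apply: (derive_along_line _ (is_derive_radial habc C t0)); near=> h.
  rewrite addrA -scalerDl tangent_trace_polar //.
  rewrite -ltrBlDr sub0r; near: h; apply: lt_nbhsr.
  by rewrite oppr_lt0.
(* Off the diagonal the first derivative already vanishes at each point of the ray, by
   reflection. *)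
rewrite mulr0; apply: (@cvg_right_eq _ _ (cst 0)); last exact: cvg_cst.
move=> t t0; rewrite subr0 derive_even ?mul0r //.
  exact: tangent_trace_differentiable.
by move=> h; exact: tangent_trace_even.
Unshelve. all: by end_near. Qed.

Lemma second_form_frame mu l k :
  second_form g s (nu mu) (e l) (e k) = 2^-1 * m * E * twist (nu mu) (e l) (e k).
Proof. by rewrite /second_form inner_nabla_const // koszul_ttn. Qed.

(* T3: by minimality the terms with nabla_nu' nu drop out of the trace, so the
   second-order jet of the metric in purely normal directions is not needed. *)
Lemma curvature_trace mu mu' :
  \sum_(l < 2) curvature g s (e l) (nu mu) (e l) (nu mu') =
  - (3 / (2 * m ^+ 2)) * (mu == mu')%:R.
Proof.
under eq_bigr => l _ do rewrite (curvature_koszul hg).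
(* [koszul_nnt] holds at every point of the slice, not only at [s]. *)
have T1 l : 'D_(e l) (koszul g (nu mu') (nu mu) (e l)) s = 0.
  by apply: (@derive_slice _ 0) => // q hq; rewrite koszul_nnt.
(* With equal outer arguments two of the Koszul terms cancel, leaving half the normal derivative of
   <e_l, e_l>. *)
have T2 : \sum_(l < 2) 'D_(nu mu') (koszul g (e l) (nu mu) (e l)) s =
    2^-1 * 'D_(nu mu') ('D_(nu mu) Phi) s.
  rewrite (_ : 'D_(nu mu) Phi = \sum_(l < 2) 'D_(nu mu) (fun q => inner g q (e l) (e l))).
    rewrite derive_sum; last by move=> l; exact: derive_inner_derivable.
    rewrite mulr_sumr; apply: eq_bigr => l _.
    rewrite (_ : koszul _ _ _ _ =
       (fun q => 2^-1 * 'D_(nu mu) (fun q => inner g q (e l) (e l)) q)).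
      have : derivable ('D_(nu mu) (fun q => inner g q (e l) (e l))) s (nu mu').
        exact: derive_inner_derivable.
      by move=> /derivableP /(is_derive_mull_fun 2^-1) [].
    by apply/funext => q; rewrite /koszul (swap (nu mu)); ring.
  by apply/funext => q; rewrite tangent_trace_derive fct_sumE.
have T3 : \sum_(l < 2) inner g s (nabla g (fun=> nu mu') (fun=> nu mu) s)
    (nabla g (fun=> e l) (fun=> e l) s) = 0.
  under eq_bigr => l _ do rewrite (innerC hg).
  rewrite -(inner_suml g) frame_parseval.
  rewrite [X in X + _]big1 => [|l _]; last first.
    by rewrite [X in _ * X]inner_nabla_const // koszul_nnt // mulr0.
  rewrite add0r big1 // => rho _; rewrite inner_suml.
  under eq_bigr => l _ do rewrite inner_nabla_const // koszul_ttn //.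
  by rewrite -mulr_sumr twist_trace mulr0 mul0r.
(* The tangential components give the square of the second fundamental form, the normal ones that of
   the normal connection. *)
have T4 : \sum_(l < 2) inner g s (nabla g (fun=> e l) (fun=> nu mu) s)
    (nabla g (fun=> nu mu') (fun=> e l) s) =
    (2^-1 * m * E) ^+ 2 * (2 * kap ^+ 2 * (mu == mu')%:R) +
    16 * C * (mu == mu')%:R.
  under eq_bigr => l _ do rewrite frame_parseval.
  rewrite big_split /=; congr (_ + _).
    rewrite -dot_nu -twist_contraction mulr_sumr; apply: eq_bigr => l _.
    rewrite mulr_sumr; apply: eq_bigr => k _.
    rewrite !inner_nabla_const // (koszulC hg (nu mu')) !koszul_tnt // -/E; ring.
  rewrite /C mulr_sumr mulr_suml; apply: eq_bigr => l _.
  rewrite -cross_contraction mulr_sumr; apply: eq_bigr => k _.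
  rewrite !inner_nabla_const // (koszulC hg (nu mu')) !koszul_tnn //; ring.
(* On the diagonal the sum is 0 - (16 C + 2/m^2) - 0 + (1/(2 m^2) + 16 C). *)
rewrite big_split !sumrB /= [X in _ + X]T4 [X in _ - X + _]T3.
rewrite [X in _ - X - _ + _]T2 [X in X - _ - _ + _]big1 // tangent_trace_hessian.
rewrite /kap; field; by rewrite E0 m0.
Qed.

Lemma second_form_contraction mu mu' :
  \sum_(l < 2) \sum_(k < 2) second_form g s (nu mu) (e l) (e k) *
     second_form g s (nu mu') (e l) (e k) = (2 * m ^+ 2)^-1 * (mu == mu')%:R.
Proof.
transitivity ((2^-1 * m * E) ^+ 2 * (2 * kap ^+ 2 * fiber_dot (nu mu) (nu mu'))).
  rewrite -twist_contraction mulr_sumr; apply: eq_bigr => l _.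
  rewrite mulr_sumr; apply: eq_bigr => k _; rewrite !second_form_frame; ring.
by rewrite dot_nu /kap; field; rewrite E0 m0.
Qed.

Lemma RminusA_frame v :
  RminusA g s e nu v = m ^- 2 *: \sum_(mu < 2) inner g s v (nu mu) *: nu mu.
Proof.
rewrite /RminusA scaler_sumr; apply: eq_bigr => mu _.
under eq_bigr => mu' _ do rewrite curvature_trace second_form_contraction.
rewrite (bigD1 mu) //= big1 ?addr0 => [|mu' mumu'].
  by rewrite eqxx !mulr1 scalerA; congr (_ *: _); field; rewrite m0.
by rewrite eq_sym (negbTE mumu') !mulr0 !oppr0 addr0 mul0r scale0r.
Qed.

Lemma inner_RminusA v w : inner g s (RminusA g s e nu v) w =
  m ^- 2 * \sum_(mu < 2) inner g s v (nu mu) * inner g s w (nu mu).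
Proof.
rewrite RminusA_frame innerZl inner_suml; congr (_ * _).
by apply: eq_bigr => mu _; rewrite innerZl (innerC hg _ (nu mu)).
Qed.

Lemma RminusA_positive : positive_definite_on g s (normal g s) (RminusA g s e nu).
Proof.
split=> [v w _ _|v nv v0].
  rewrite (innerC hg _ v) !inner_RminusA; congr (_ * _).
  by apply: eq_bigr => mu _; rewrite mulrC.
rewrite inner_RminusA mulr_gt0 ?invr_gt0 ?exprn_gt0 //.
(* For a normal vector Parseval has no tangential terms, so the remaining sum is its squared
   length. *)
have := inner_neq0 hg s v0; rewrite frame_parseval.
by rewrite [X in X + _]big1 ?add0r // => l _; rewrite nv ?mul0r.
Qed.

Lemma mean_curvature0 mu :
  \sum_(l < 2) second_form g s (nu mu) (e l) (e l) = 0.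
Proof.
under eq_bigr => l _ do rewrite second_form_frame.
by rewrite -mulr_sumr twist_trace mulr0.
Qed.

End Frame.

Lemma polar_metric_strongly_stable : strongly_stable g.
Proof.
by split=> s e nu hs fr; [exact: mean_curvature0|exact: RminusA_positive].
Qed.

End StrongStability.

(** * The polar form in the two charts *)

Section Points.
Local Open Scope classical_set_scope.
Local Open Scope complex_scope.
Variable R : realType.
Implicit Types (n p q s v w : 'rV[R]_(2 + 2)) (z zeta : R[i]).

Lemma zre_point z zeta : zre (Defs.point z zeta) = complex.Re z.
Proof. by rewrite /zre /Defs.point row_mxKl mxE. Qed.
Lemma zim_point z zeta : zim (Defs.point z zeta) = complex.Im z.
Proof. by rewrite /zim /Defs.point row_mxKl mxE. Qed.
Lemma fre_point z zeta : fre (Defs.point z zeta) = complex.Re zeta.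
Proof. by rewrite /fre /Defs.point row_mxKr mxE. Qed.
Lemma fim_point z zeta : fim (Defs.point z zeta) = complex.Im zeta.
Proof. by rewrite /fim /Defs.point row_mxKr mxE. Qed.

Lemma coord_ext v w : zre v = zre w -> zim v = zim w -> fre v = fre w -> fim v = fim w ->
  v = w.
Proof.
move=> h1 h2 h3 h4; rewrite -[v]hsubmxK -[w]hsubmxK.
by congr row_mx; apply/rowP => i; have [->|->] := ord2_eq i.
Qed.

Lemma coord_linear (F : 'rV[R]_(2 + 2) -> R) (h : R) v w :
  [\/ F = @zre R, F = @zim R, F = @fre R | F = @fim R] ->
  F (h *: v + w) = h * F v + F w.
Proof. by case=> ->; rewrite /zre /zim /fre /fim linearD linearZ !mxE. Qed.

Lemma divc_real z (x : R) : z / x%:C = (complex.Re z / x) +i* (complex.Im z / x).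
Proof. by rewrite -fmorphV; case: z => u v; simpc. Qed.

Lemma sqr_normc (x y : R) : Normc.normc (x +i* y) ^+ 2 = x ^+ 2 + y ^+ 2.
Proof. by rewrite sqr_sqrtr // addr_ge0 // sqr_ge0. Qed.

Lemma unit_angle (x y : R) : x ^+ 2 + y ^+ 2 = 1 ->
  exists psi : R, cos psi = x /\ sin psi = y.
Proof.
move=> xy.
have x1 : -1 <= x <= 1.
  rewrite -ler_norml -(@ler_pXn2r _ 2) // ?nnegrE //.
  by rewrite expr1n real_normK ?num_real // -xy lerDl sqr_ge0.
have yE : Num.sqrt (1 - x ^+ 2) = `|y| by rewrite -xy addrC addKr sqrtr_sqr.
have [y0|y0] := leP 0 y.
  exists (acos x); rewrite acosK ?in_itv // sin_acos // yE ger0_norm //.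
exists (- acos x); rewrite cosN sinN acosK ?in_itv // sin_acos // yE.
by rewrite ltr0_norm // opprK.
Qed.

Lemma sigma1E (z dz : R[i]) (dpsi : R) :
  sigma1 z dz dpsi = dpsi / 2 + 2 * (complex.Re z * complex.Im dz
     - complex.Im z * complex.Re dz) / (1 + complex.Re z ^+ 2 + complex.Im z ^+ 2).
Proof.
case: z dz => x y [u v]; rewrite /sigma1 sqr_normc.
have e2 : (2 : R[i]) = (2 : R)%:C by rewrite rmorph_nat.
have e1 : 1 + (x ^+ 2 + y ^+ 2)%:C = (1 + x ^+ 2 + y ^+ 2)%:C.
  by rewrite -addrA [RHS]rmorphD rmorph1.
rewrite e1 e2 divc_real [_ ^-1 * _]mulrC divc_real /=.
by field; rewrite gt_eqF // -addrA ltr_wpDr // addr_ge0 // sqr_ge0.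
Qed.

Lemma sigma23E (z dz : R[i]) (psi : R) :
  let D := 1 + complex.Re z ^+ 2 + complex.Im z ^+ 2 in
  sigma2 z psi dz = 2 * (cos (psi / 2) * complex.Re dz
      - sin (psi / 2) * complex.Im dz) / D /\
  sigma3 z psi dz = 2 * (cos (psi / 2) * complex.Im dz
      + sin (psi / 2) * complex.Re dz) / D.
Proof.
case: z dz => x y [u v]; rewrite /sigma2 /sigma3 /sigma23 sqr_normc.
have e2 : (2 : R[i]) = (2 : R)%:C by rewrite rmorph_nat.
have e1 : 1 + (x ^+ 2 + y ^+ 2)%:C = (1 + x ^+ 2 + y ^+ 2)%:C.
  by rewrite -addrA [RHS]rmorphD rmorph1.
by rewrite e1 e2 divc_real /=; split; congr (_ / _); ring.
Qed.

End Points.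

(** * The z-chart: from [ds2] to the polar form *)

Section PolarChart.
Local Open Scope classical_set_scope.
Local Open Scope complex_scope.
Variables (R : realType) (a b c : R -> R).
Variable g : 'rV[R]_(2 + 2) -> 'M[R]_(2 + 2).
Hypothesis hg : riemannian_metric g.
Hypothesis hpol : forall (z : R[i]) (r psi : R) (dz : R[i]) (dr dpsi : R), 0 < r ->
  let v := Defs.point dz ((dr +i* (r * dpsi)) * expi psi) in
  inner g (Defs.point z (r%:C * expi psi)) v v = ds2 a b c z r psi dz dr dpsi.
Implicit Types (n p q s v w : 'rV[R]_(2 + 2)).

Lemma polar_quadratic s n v (t : R) : on_slice s -> vertical n ->
  fiber_dot n n = 1 -> 0 < t ->
  inner g (t *: n + s) v v = polar_form a b c t n s v v.
Proof.
move=> hs vn nn t0.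
have [psi [cpsi spsi]] : exists psi : R, cos psi = fre n /\ sin psi = fim n.
  by apply: unit_angle; rewrite -nn /fiber_dot; ring.
have tn0 : t != 0 by rewrite gt_eqF.
have [s1 s2] := tangent_fiber hs; have [n1 n2] := vertical_base vn.
have pE : t *: n + s = Defs.point (zre s +i* zim s) (t%:C * expi psi).
  apply: coord_ext; rewrite coord_linear; try by [constructor|constructor 2|constructor 3|constructor 4].
  - by rewrite zre_point n1 mulr0 add0r.
  - by rewrite zim_point n2 mulr0 add0r.
  - by rewrite fre_point s1 /= cpsi; ring.
  - by rewrite fim_point s2 /= spsi; ring.
(* The radial and angular parts of the fiber velocity are dr = [fiber_dot n v] and r dpsi =
   [fiber_cross n v], with r = t. *)
have vE : v = Defs.point (zre v +i* zim v)
    ((fiber_dot n v +i* (t * (fiber_cross n v / t))) * expi psi).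
  rewrite [t * _]mulrC mulfVK //.
  apply: coord_ext; rewrite ?zre_point ?zim_point ?fre_point ?fim_point //=
     cpsi spsi -[LHS]mul1r -nn /fiber_dot /fiber_cross; ring.
rewrite pE {1 2}vE hpol // /ds2 sigma1E /=.
have [-> ->] := sigma23E (zre s +i* zim s) (zre v +i* zim v) psi.
rewrite /polar_form /connection /conformal /base_dot /twist -cpsi -spsi /=.
have -> : psi = psi / 2 + psi / 2 by field.
rewrite cosD sinD (_ : (psi / 2 + psi / 2) / 2 = psi / 2); last by field.
set co := cos (psi / 2); set si := sin (psi / 2).
have cs : co ^+ 2 + si ^+ 2 = 1 by exact: cos2Dsin2.
have D0 : 1 + zre s ^+ 2 + zim s ^+ 2 != 0.
  by rewrite gt_eqF // -addrA ltr_wpDr // addr_ge0 // sqr_ge0.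
(* Inserting cos^2 + sin^2 makes the base terms homogeneous of degree 2 in the half-angle functions,
   so they agree as polynomials. *)
have -> : (b t ^+ 2 + c t ^+ 2) / 2 = (b t ^+ 2 + c t ^+ 2) / 2 * (co ^+ 2 + si ^+ 2).
  by rewrite cs mulr1.
by field; rewrite D0 tn0.
Qed.

(** [ds2] prescribes only the quadratic form; polarization recovers the bilinear one. *)
Lemma polar_chart : polar_metric a b c g.
Proof.
move=> s n v w t hs vn nn t0.
have hv x := polar_quadratic x hs vn nn t0.
have polar : inner g (t *: n + s) v w = 4^-1 *
   (inner g (t *: n + s) (v + w) (v + w) - inner g (t *: n + s) (v - w) (v - w)).
  have quad (k : R) p : inner g p (v + k *: w) (v + k *: w) =
      inner g p v v + 2 * k * inner g p v w + k ^+ 2 * inner g p w w.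
    rewrite innerDl innerZl (innerC hg p v (v + _)) (innerC hg p w (v + _)).
    by rewrite !innerDl !innerZl (innerC hg p w v); ring.
  have := quad 1 (t *: n + s); rewrite scale1r => ->.
  by have := quad (-1) (t *: n + s); rewrite scaleN1r => ->; field.
have L F : [\/ F = @zre R, F = @zim R, F = @fre R | F = @fim R] ->
    (F (v + w) = F v + F w) * (F (v - w) = F v - F w).
  move=> hF; split; first by rewrite -[v]scale1r coord_linear // scale1r mul1r.
  by rewrite addrC -scaleN1r coord_linear // mulN1r addrC.
have L1 := L _ (Or41 _ _ _ (erefl (@zre R))).
have L2 := L _ (Or42 _ _ _ (erefl (@zim R))).
have L3 := L _ (Or43 _ _ _ (erefl (@fre R))).
have L4 := L _ (Or44 _ _ _ (erefl (@fim R))).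
have LC : (connection s (v + w) = connection s v + connection s w) *
    (connection s (v - w) = connection s v - connection s w).
  by split; rewrite /connection ?L1 ?L2 -?mulrDl -?mulrBl; congr (_ / _); ring.
rewrite polar !hv /polar_form !LC.
rewrite /fiber_dot /fiber_cross /base_dot /twist !L1 !L2 !L3 !L4.
by field; rewrite gt_eqF.
Qed.

End PolarChart.

(** * The transition map and its differential in real coordinates *)

Section Transition.
Local Open Scope classical_set_scope.
Local Open Scope complex_scope.
Variable R : realType.
Implicit Types (n p q s v w : 'rV[R]_(2 + 2)) (z zeta : R[i]).

Definition base_sq p : R := zre p ^+ 2 + zim p ^+ 2.
(** The differential of arg z along [v]. *)
Definition base_turn p v : R := (zre p * zim v - zim p * zre v) / base_sq p.
(* (z / |z|)^4 = rot_re + i rot_im *)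
Definition rot_re p : R :=
  (zre p ^+ 4 - 6 * zre p ^+ 2 * zim p ^+ 2 + zim p ^+ 4) * (base_sq p)^-1 ^+ 2.
Definition rot_im p : R :=
  4 * zre p * zim p * (zre p ^+ 2 - zim p ^+ 2) * (base_sq p)^-1 ^+ 2.

Lemma base_sq_neq0 p : base p != 0 -> base_sq p != 0.
Proof.
apply: contra; rewrite /base_sq paddr_eq0 ?sqr_ge0 // !sqrf_eq0.
by rewrite eq_complex /= => /andP[-> ->].
Qed.

Lemma base_neq0 p : base_sq p != 0 -> base p != 0.
Proof.
apply: contra; rewrite eq_complex /= => /andP[/eqP x0 /eqP y0].
by rewrite /base_sq /zre /zim x0 y0 expr0n addr0.
Qed.

Lemma rot_unit p : base_sq p != 0 -> rot_re p ^+ 2 + rot_im p ^+ 2 = 1.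
Proof. by move=> N0; rewrite /rot_re /rot_im /base_sq; field. Qed.

(** The modulus of z occurs only to even powers, so the coordinates are rational functions without
    square roots. *)
Lemma transitionE p : [/\ zre (transition p) = zre p * (base_sq p)^-1,
  zim (transition p) = - zim p * (base_sq p)^-1,
  fre (transition p) = fre p * rot_re p - fim p * rot_im p &
  fim (transition p) = fre p * rot_im p + fim p * rot_re p].
Proof.
rewrite /transition zre_point zim_point fre_point fim_point.
rewrite /base /fiber /row_complex -/(zre p) -/(zim p) -/(fre p) -/(fim p).
rewrite divc_real /=.
set k := Num.sqrt _.
have k4 : (base_sq p)^-1 ^+ 2 = (k^-1) ^+ 4.
  transitivity ((k ^+ 2)^-1 ^+ 2); last by rewrite -exprVn -exprM.
  by rewrite sqr_sqrtr // addr_ge0 // sqr_ge0.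
split.
- by [].
- by rewrite mulNr.
- by rewrite /rot_re /rot_im k4; ring.
- by rewrite /rot_re /rot_im k4; ring.
Qed.

Lemma is_derive_coord (F : 'rV[R]_(2 + 2) -> R) p v :
  [\/ F = @zre R, F = @zim R, F = @fre R | F = @fim R] -> is_derive p v F (F v).
Proof.
move=> hF.
have cF : h^-1 *: ((F \o shift p) (h *: v) - F p) @[h --> 0^'] --> F v.
  apply: (@cvg_trans _ ((cst (F v) h) @[h --> 0^'])); last exact: cvg_cst.
  apply: near_eq_cvg; near=> h.
  have h0 : h != 0 by near: h; exact: nbhs_dnbhs_neq.
  by rewrite /= coord_linear // addrK scalerA mulVf // scale1r.
by split; [apply/cvg_ex; exists (F v)|exact: cvg_lim].
Unshelve. all: by end_near. Qed.

Lemma is_derive_inv_fun (f : 'rV[R]_(2 + 2) -> R) p v (df : R) : f p != 0 ->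
  is_derive p v f df -> is_derive p v (fun q => (f q)^-1) (- df * (f p)^-1 ^+ 2).
Proof.
move=> f0 [df1 <-]; split; first exact: derivableV.
by rewrite deriveV // exprVn /GRing.scale /= !mulNr mulrC.
Qed.

Lemma derive_coord_transition (F : 'rV[R]_(2 + 2) -> R) p v :
  [\/ F = @zre R, F = @zim R, F = @fre R | F = @fim R] ->
  F (dirD (@transition R) p v) = 'D_v (fun q => F (transition q)) p.
Proof.
by case=> ->; rewrite /zre /zim /fre /fim !mxE; congr ('D_v _ p);
  apply/funext => q; rewrite !mxE.
Qed.

(** In complex terms the base part is -dz/z^2, and the fiber part is dzeta + 4i d(arg z) zeta
    rotated by (z/|z|)^4. *)
Lemma dir_transition p v : base p != 0 ->
  let T := dirD (@transition R) p v in
  [/\ zre T = - (zre v * (zre p ^+ 2 - zim p ^+ 2) + zim v * (2 * zre p * zim p))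
             * (base_sq p)^-1 ^+ 2,
      zim T = - (zim v * (zre p ^+ 2 - zim p ^+ 2) - zre v * (2 * zre p * zim p))
             * (base_sq p)^-1 ^+ 2,
      fre T = (fre v - 4 * base_turn p v * fim p) * rot_re p
             - (fim v + 4 * base_turn p v * fre p) * rot_im p &
      fim T = (fre v - 4 * base_turn p v * fim p) * rot_im p
             + (fim v + 4 * base_turn p v * fre p) * rot_re p].
Proof.
move=> /base_sq_neq0 N0 T.
have dx : is_derive p v (@zre R) (zre v) by apply: is_derive_coord; constructor.
have dy : is_derive p v (@zim R) (zim v) by apply: is_derive_coord; constructor 2.
have df : is_derive p v (@fre R) (fre v) by apply: is_derive_coord; constructor 3.
have dg : is_derive p v (@fim R) (fim v) by apply: is_derive_coord; constructor 4.
have dN : is_derive p v base_sq (2 * (zre p * zre v + zim p * zim v)).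
  rewrite (_ : base_sq = fun q => zre q * zre q + zim q * zim q); last first.
    by apply/funext => q; rewrite /base_sq !expr2.
  apply: is_derive_eq; rewrite /GRing.scale /=.
  by ring.
have dI := is_derive_inv_fun N0 dN.
have dP : is_derive p v rot_re (- 4 * base_turn p v * rot_im p).
  rewrite (_ : rot_re = fun q => (zre q * zre q * (zre q * zre q) +
     - 6 * (zre q * zre q * (zim q * zim q)) + zim q * zim q * (zim q * zim q)) *
     ((base_sq q)^-1 * (base_sq q)^-1)); last first.
    by apply/funext => q; rewrite /rot_re; ring.
  apply: is_derive_eq; rewrite /GRing.scale /=.
  by rewrite /base_turn /rot_im /base_sq in N0 *; field.
have dQ : is_derive p v rot_im (4 * base_turn p v * rot_re p).
  rewrite (_ : rot_im = fun q => 4 * (zre q * zim q *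
     (zre q * zre q + - 1 * (zim q * zim q)) *
     ((base_sq q)^-1 * (base_sq q)^-1))); last first.
    by apply/funext => q; rewrite /rot_im; ring.
  apply: is_derive_eq; rewrite /GRing.scale /=.
  by rewrite /base_turn /rot_re /base_sq in N0 *; field.
have ext (F G : 'rV[R]_(2 + 2) -> R) d :
    [\/ F = @zre R, F = @zim R, F = @fre R | F = @fim R] ->
    (forall q, F (transition q) = G q) -> is_derive p v G d -> F T = d.
  move=> hF FG [_ <-]; rewrite /T derive_coord_transition //.
  by congr ('D_v _ p); apply/funext.
split.
- apply: (ext _ (fun q => zre q * (base_sq q)^-1)); first by constructor.
    by move=> q; have [] := transitionE q.
  apply: is_derive_eq; rewrite /GRing.scale /=.
  by rewrite /base_sq in N0 *; field.
- apply: (ext _ (fun q => - 1 * zim q * (base_sq q)^-1)); first by constructor 2.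
    by move=> q; have [_ -> _ _] := transitionE q; rewrite mulN1r.
  apply: is_derive_eq; rewrite /GRing.scale /=.
  by rewrite /base_sq in N0 *; field.
- apply: (ext _ (fun q => fre q * rot_re q + - 1 * (fim q * rot_im q))).
  + by constructor 3.
  + by move=> q; have [_ _ -> _] := transitionE q; rewrite mulN1r.
  apply: is_derive_eq; rewrite /GRing.scale /=.
  by ring.
apply: (ext _ (fun q => fre q * rot_im q + fim q * rot_re q)).
- by constructor 4.
- by move=> q; have [_ _ _ ->] := transitionE q.
apply: is_derive_eq; rewrite /GRing.scale /=.
by ring.
Qed.

Lemma transition_base p : base_sq p != 0 ->
  [/\ base_sq (transition p) = (base_sq p)^-1,
      rot_re (transition p) = rot_re p & rot_im (transition p) = - rot_im p].
Proof.
move=> N0; have [X Y _ _] := transitionE p.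
have N' : base_sq (transition p) = (base_sq p)^-1.
  by rewrite [LHS]/base_sq X Y /base_sq in N0 *; field.
split=> //.
  by rewrite [LHS]/rot_re N' X Y /rot_re invrK /base_sq in N0 *; field.
by rewrite [LHS]/rot_im N' X Y /rot_im invrK /base_sq in N0 *; field.
Qed.

Lemma transition_involutive p : base p != 0 -> transition (transition p) = p.
Proof.
move=> /base_sq_neq0 N0; have [X Y F G] := transitionE p.
have [X' Y' F' G'] := transitionE (transition p).
have U := rot_unit N0; have [N' P' Q'] := transition_base N0.
apply: coord_ext.
- by rewrite X' N' X invrK mulfVK.
- by rewrite Y' N' Y invrK !mulNr opprK mulfVK.
- rewrite F' P' Q' F G.
  transitivity (fre p * (rot_re p ^+ 2 + rot_im p ^+ 2)); first by ring.
  by rewrite U mulr1.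
rewrite G' P' Q' F G.
transitivity (fim p * (rot_re p ^+ 2 + rot_im p ^+ 2)); first by ring.
by rewrite U mulr1.
Qed.

(** Together with [transition_involutive] this lets the gluing identity, stated from [gz] to [gw],
    be read backwards. *)
Lemma dir_transition_involutive p v : base p != 0 ->
  dirD (@transition R) (transition p) (dirD (@transition R) p v) = v.
Proof.
move=> b0; have N0 := base_sq_neq0 b0.
have [X Y F G] := transitionE p; have U := rot_unit N0.
have [N' P' Q'] := transition_base N0.
have b0' : base (transition p) != 0 by apply: base_neq0; rewrite N' invr_eq0.
have [x1 y1 f1 g1] := dir_transition v b0.
have [x2 y2 f2 g2] := dir_transition (dirD (@transition R) p v) b0'.
have J' : base_turn (transition p) (dirD (@transition R) p v) = - base_turn p v.
  by rewrite /base_turn N' X Y x1 y1 /base_sq in N0 *; field.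
apply: coord_ext.
- by rewrite x2 N' X Y x1 y1 /base_sq in N0 *; field.
- by rewrite y2 N' X Y x1 y1 /base_sq in N0 *; field.
- rewrite f2 J' P' Q' F G f1 g1.
  transitivity (fre v * (rot_re p ^+ 2 + rot_im p ^+ 2)); first by ring.
  by rewrite U mulr1.
rewrite g2 J' P' Q' F G f1 g1.
transitivity (fim v * (rot_re p ^+ 2 + rot_im p ^+ 2)); first by ring.
by rewrite U mulr1.
Qed.

End Transition.

(** * The w-chart: invariance of the polar form, and the fiber over w = 0 *)

Section OtherChart.
Local Open Scope classical_set_scope.
Local Open Scope complex_scope.
Variables (R : realType) (a b c : R -> R).
Variables gz gw : 'rV[R]_(2 + 2) -> 'M[R]_(2 + 2).
Hypotheses (hgw : riemannian_metric gw) (hz : polar_metric a b c gz).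
Hypothesis glue : forall p v w : 'rV[R]_(2 + 2), base p != 0 ->
  inner gz p v w =
  inner gw (transition p) (dirD (@transition R) p v) (dirD (@transition R) p w).
Implicit Types (n p q s v w : 'rV[R]_(2 + 2)).

(* sigma1, sigma2, sigma3 have the same expressions in both charts, up to a
   common sign of sigma2 and sigma3. *)
Lemma polar_form_transition s n v w (t : R) : on_slice s -> vertical n ->
  fiber_dot n n = 1 -> 0 < t -> base_sq s != 0 ->
  let T := dirD (@transition R) (t *: n + s) in
  exists s' n', [/\ on_slice s', vertical n', fiber_dot n' n' = 1,
    transition (t *: n + s) = t *: n' + s' &
    polar_form a b c t n' s' (T v) (T w) = polar_form a b c t n s v w].
Proof.
move=> hs vn nn t0 N0 T; set q := t *: n + s.
have [s1 s2] := tangent_fiber hs; have [n1 n2] := vertical_base vn.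
have qx : zre q = zre s.
  by rewrite coord_linear ?n1 ?mulr0 ?add0r //; constructor.
have qy : zim q = zim s.
  by rewrite coord_linear ?n2 ?mulr0 ?add0r //; constructor 2.
have qf : fre q = t * fre n.
  by rewrite coord_linear ?s1 ?addr0 //; constructor 3.
have qg : fim q = t * fim n.
  by rewrite coord_linear ?s2 ?addr0 //; constructor 4.
have Nq : base_sq q = base_sq s by rewrite /base_sq qx qy.
have Pq : rot_re q = rot_re s by rewrite /rot_re Nq qx qy.
have Qq : rot_im q = rot_im s by rewrite /rot_im Nq qx qy.
have bq : base q != 0 by apply: base_neq0; rewrite Nq.
pose P := rot_re s; pose Q := rot_im s; pose N := base_sq s.
have PQ : P ^+ 2 + Q ^+ 2 = 1 by exact: rot_unit.
(* The new base point is 1/z, and the new unit direction is [n] rotated by (z/|z|)^4; the radius t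
   is unchanged. *)
pose s' : 'rV[R]_(2 + 2) :=
  Defs.point ((zre s * N^-1) +i* (- zim s * N^-1)) (0 +i* 0).
pose n' : 'rV[R]_(2 + 2) := Defs.point (0 +i* 0)
  ((fre n * P - fim n * Q) +i* (fre n * Q + fim n * P)).
have sx : zre s' = zre s * N^-1 by rewrite zre_point.
have sy : zim s' = - zim s * N^-1 by rewrite zim_point.
have nx : fre n' = fre n * P - fim n * Q by rewrite fre_point.
have ny : fim n' = fre n * Q + fim n * P by rewrite fim_point.
have hs' : on_slice s'.
  apply/rowP => i; rewrite [RHS]mxE; have [->|->] := ord2_eq i.
    exact: (fre_point (R := R)).
  exact: (fim_point (R := R)).
have vn' : vertical n' by apply: vertical_coord; rewrite ?zre_point ?zim_point.
have dotn v' w' : 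
    (fre v' * P - fim v' * Q) * (fre w' * P - fim w' * Q) +
    (fre v' * Q + fim v' * P) * (fre w' * Q + fim w' * P) = fiber_dot v' w'.
  transitivity (fiber_dot v' w' * (P ^+ 2 + Q ^+ 2)).
    by rewrite /fiber_dot; ring.
  by rewrite PQ mulr1.
exists s', n'; split=> //.
- by rewrite /fiber_dot nx ny dotn.
- have [X Y F G] := transitionE q.
  apply: coord_ext; rewrite coord_linear; try by [constructor|constructor 2|constructor 3|constructor 4].
  + by rewrite X qx Nq sx zre_point mulr0 add0r.
  + by rewrite Y qy Nq sy zim_point mulr0 add0r.
  + by rewrite F qf qg Pq Qq nx fre_point -/P -/Q addr0; ring.
  + by rewrite G qf qg Pq Qq ny fim_point -/P -/Q addr0; ring.
have D0 : 1 + zre s ^+ 2 + zim s ^+ 2 != 0.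
  by rewrite gt_eqF // -addrA ltr_wpDr // addr_ge0 // sqr_ge0.
have D0' : base_sq s + 1 != 0 by rewrite addrC /base_sq addrA.
have DN : 1 + zre s' ^+ 2 + zim s' ^+ 2 = (base_sq s + 1) * N^-1.
  by rewrite sx sy /N /base_sq in N0 *; field.
pose J v' := base_turn s v'.
have TE v' : [/\ fiber_dot n' (T v') = fiber_dot n v',
    fiber_cross n' (T v') + 4 * t * connection s' (T v') =
      fiber_cross n v' + 4 * t * connection s v' ,
    zre (T v') = - (zre v' * (zre s ^+ 2 - zim s ^+ 2) + zim v' * (2 * zre s * zim s))
             * N^-1 ^+ 2 &
    zim (T v') = - (zim v' * (zre s ^+ 2 - zim s ^+ 2) - zre v' * (2 * zre s * zim s))
             * N^-1 ^+ 2].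
  have [X Y F G] := dir_transition v' bq.
  have Jq : base_turn q v' = base_turn s v' by rewrite /base_turn Nq qx qy.
  rewrite Nq qx qy Jq qf qg Pq Qq -/P -/Q -/N in X Y F G.
  split=> //.
  - rewrite /fiber_dot nx ny F G.
    transitivity (fiber_dot n v' * (P ^+ 2 + Q ^+ 2)); last by rewrite PQ mulr1.
    by rewrite /fiber_dot; ring.
  have -> : fiber_cross n' (T v') = fiber_cross n v' + 4 * t * base_turn s v'.
    rewrite /fiber_cross nx ny F G.
    transitivity ((fiber_cross n v' + 4 * base_turn s v' * t * fiber_dot n n) *
       (P ^+ 2 + Q ^+ 2)); first by rewrite /fiber_cross /fiber_dot; ring.
    by rewrite PQ nn /fiber_cross; ring.
  (* This gauge change of the connection offsets the turn 4 d(arg z) of the fiber angle, so sigma1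
     is preserved. *)
  have -> : connection s' (T v') = connection s v' - base_turn s v'.
    rewrite /connection DN sx sy X Y /base_turn /N /base_sq in N0 D0' *.
    by field; rewrite ?D0 ?D0' ?N0.
  by ring.
clearbody T.
have [dv cv xv yv] := TE v; have [dw cw xw yw] := TE w.
have k1 : N * N^-1 = 1 by rewrite mulfV.
(* With |dz|^2 scaling by |z|^(-4), this is the invariance of the round metric under inversion. *)
have cE : conformal s' * N^-1 ^+ 2 = conformal s.
  rewrite /conformal DN /N /base_sq in N0 D0' *.
  by field; rewrite ?D0 ?D0' ?N0.
have hb : conformal s' * base_dot (T v) (T w) = conformal s * base_dot v w.
  rewrite -cE -mulrA; congr (_ * _).
  transitivity ((N * N^-1) ^+ 2 * (N^-1 ^+ 2 * base_dot v w)).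
    rewrite /base_dot xv yv xw yw.
    by move: (N^-1) => k; rewrite /N /base_sq; ring.
  by rewrite k1 expr1n mul1r.
(* In Re(n v w) the two factors -1/z^2 meet the rotation (z/|z|)^4, leaving the positive factor
   |z|^(-4). *)
have ht : conformal s' * twist n' (T v) (T w) = conformal s * twist n v w.
  rewrite -cE -mulrA; congr (_ * _).
  transitivity ((N * N^-1) ^+ 4 * (N^-1 ^+ 2 * twist n v w)).
    rewrite /twist nx ny xv yv xw yw /P /Q /rot_re /rot_im -/N.
    by move: (N^-1) => k; rewrite /N /base_sq; ring.
  by rewrite k1 expr1n mul1r.
rewrite /polar_form dv dw cv cw; congr (_ + _).
have factor (k x y A B : R) : k * (A * x + B * y) = A * (k * x) + B * (k * y).
  by ring.
by rewrite [LHS]factor [RHS]factor hb ht.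
Qed.

Lemma glue_sym q v w : base q != 0 -> base (transition q) != 0 ->
  inner gw q v w =
  inner gz (transition q) (dirD (@transition R) q v) (dirD (@transition R) q w).
Proof.
move=> b0 b1; apply: (eq_trans _ (esym (glue _ _ b1))).
exact: (f_equal3 (inner gw) (esym (transition_involutive b0))
  (esym (dir_transition_involutive v b0)) (esym (dir_transition_involutive w b0))).
Qed.

Lemma polar_chart_transition_generic s n v w (t : R) : on_slice s -> vertical n ->
  fiber_dot n n = 1 -> 0 < t -> base_sq s != 0 ->
  inner gw (t *: n + s) v w = polar_form a b c t n s v w.
Proof.
move=> hs vn nn t0 N0.
have [s' [n' [hs' vn' nn' Tq <-]]] := polar_form_transition v w hs vn nn t0 N0.
have N1 : base_sq (t *: n + s) != 0.
  have [n1 n2] := vertical_base vn; rewrite /base_sq.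
  rewrite [zre _]coord_linear; last by constructor.
  rewrite [zim _]coord_linear; last by constructor 2.
  by rewrite n1 n2 mulr0 !add0r.
have b0 := base_neq0 N1; have [N2 _ _] := transition_base N1.
have b1 : base (transition (t *: n + s)) != 0 by apply: base_neq0; rewrite N2 invr_eq0.
by rewrite (glue_sym v w b0 b1) Tq; apply: hz.
Qed.

(** The gluing says nothing over w = 0. There both sides are continuous in the base point, so the
    identity follows by letting the base point tend to 0 along the real axis. *)
Lemma polar_chart_transition : polar_metric a b c gw.
Proof.
move=> s n v w t hs vn nn t0.
have [N0|N0] := eqVneq (base_sq s) 0; last exact: polar_chart_transition_generic.
have [s1 s2] : zre s = 0 /\ zim s = 0.
  move/eqP: N0; rewrite /base_sq paddr_eq0 ?sqr_ge0 // !sqrf_eq0.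
  by move=> /andP[/eqP ? /eqP ?].
pose e1 : 'rV[R]_(2 + 2) := Defs.point (1 +i* 0) (0 +i* 0).
pose se (h : R) := h *: e1 + s.
have e1s : tangent e1.
  apply/rowP => i; rewrite [RHS]mxE; have [->|->] := ord2_eq i.
    exact: (fre_point (R := R)).
  exact: (fim_point (R := R)).
have hse h : on_slice (se h).
  by rewrite /on_slice linearD linearZ /= e1s hs scaler0 addr0.
have sx h : zre (se h) = h.
  by rewrite coord_linear ?zre_point ?s1 ?addr0 ?mulr1 //; constructor.
have sy h : zim (se h) = 0.
  by rewrite coord_linear ?zim_point ?s2 ?addr0 ?mulr0 //; constructor 2.
have lim1 := cvg_right_line (p := t *: n + s) e1
  (differentiable_continuous (inner_differentiable hgw v w _)).
apply: (cvg_right_unique lim1).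
apply: (@cvg_right_eq _ _ (fun h => polar_form a b c t n (se h) v w)).
  move=> h h0; rewrite -(polar_chart_transition_generic v w (hse h) vn nn t0).
    by rewrite /se addrCA.
  by rewrite /base_sq sx sy expr0n addr0 expf_neq0 // gt_eqF.
have cI : (1 + h ^+ 2 + 0 ^+ 2)^-1 @[h --> 0^'+] --> ((1 + 0 ^+ 2 + 0 ^+ 2)^-1 : R).
  apply: cvgV; first by rewrite expr0n /= !addr0 oner_neq0.
  apply: cvgD; last exact: cvg_cst.
  by apply: cvgD; [exact: cvg_cst|apply: cvgM; exact: cvg_right_id].
have cA x : connection (se h) x @[h --> 0^'+] --> connection s x.
  rewrite /connection s1 s2.
  apply: (@cvg_right_eq _ _ (fun h => (h * zim x - 0 * zre x) * (1 + h ^+ 2 + 0 ^+ 2)^-1)).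
    by move=> h _; rewrite sx sy.
  apply: cvgM => //; apply: cvgB; last exact: cvg_cst.
  by apply: cvgM; [exact: cvg_right_id|exact: cvg_cst].
have cE : conformal (se h) @[h --> 0^'+] --> conformal s.
  rewrite /conformal s1 s2.
  apply: (@cvg_right_eq _ _ (fun h => 4 * ((1 + h ^+ 2 + 0 ^+ 2)^-1 ^+ 2))).
    by move=> h _; rewrite sx sy exprVn.
  by rewrite -exprVn; apply: cvgM; [exact: cvg_cst|exact: cvgM].
rewrite /polar_form; apply: cvgD; last first.
  by apply: cvgM => //; exact: cvg_cst.
apply: cvgD; first exact: cvg_cst.
apply: cvgM; [apply: cvgM; first exact: cvg_cst|];
  by apply: cvgD; [exact: cvg_cst|apply: cvgM => //; exact: cvg_cst].
Qed.

End OtherChart.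

Theorem proposition3p1 (R : realType) (m : R) (a b c : R -> R)
    (gz gw : 'rV[R]_(2 + 2) -> 'M[R]_(2 + 2))
    (hm : 0 < m) (habc : AH_profile m a b c) (hg : AH_metric a b c gz gw) :
  strongly_stable gz /\ strongly_stable gw.
Proof.
case: hg => hgz hgw glue hpol.
have hz := polar_chart hgz hpol.
have hw := polar_chart_transition hgw hz glue.
by split; [exact: (polar_metric_strongly_stable hm habc hgz hz)
          |exact: (polar_metric_strongly_stable hm habc hgw hw)].
Qed.
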